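(* Let $K$ be a classical knot diagram, formed by one isolated classical crossing $v$ and a classical tangle $T$, with unknotting number one and non-unit Jones polynomial ($V_K(t)\neq 1$). Let $K_s$ be obtained from $K$ by switching the crossing $v$ and let $K_v$ be obtained from $K$ by virtualizing $v$. If $K_s$ is the unknot, then $K_v$ is non-classical and non-trivial.
   Context: A virtual knot is an equivalence class of planar knot diagrams with classical and virtual crossings, under the classical Reidemeister moves together with the move replacing an arc containing only virtual crossings by any other arc with the same endpoints (all of whose new crossings are virtual). It is non-classical if it is not equivalent to any diagram without virtual crossings, and non-trivial if it is not equivalent to a crossingless diagram. The crossing $v$ lies in a disk meeting $K$ only in $v$ and four ends, and $T$ is the complementary part of the diagram. Virtualizing $v$ means replacing the tangle consisting of the single crossing $v$ by the tangle consisting of the opposite (switched) crossing flanked by two virtual crossings. (Equivalently, the Gauss diagram of $K_v$ is that of $K$ with the sign of $v$ reversed and the over/under information at $v$ unchanged.) $V_K(t)$ denotes the Jones polynomial, normalized to be $1$ on the unknot. *)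

(* Defs.v *)
From Stdlib Require Import Relations.Relation_Operators.
From HB Require Import structures.
From mathcomp Require Import all_boot all_order all_algebra.

Set Implicit Arguments.
Unset Strict Implicit.
Unset Printing Implicit Defensive.

Import GRing.Theory.

Local Open Scope ring_scope.

(* Diagrams.  An oriented knot diagram on the sphere, with classical and       *)
(* virtual crossings, is the cyclic list of the passages of the knot through   *)
(* all of its crossings, starting from a base point; [::] is the crossingless  *)
(* circle.  [dir p] is true iff, at the passage p, the other strand crosses    *)
(* the travelling strand from right to left.  A classical crossing is positive *)
(* iff [dir] is true at its over-passage.  This determines the 4-valent graph  *)
(* with its rotation system, hence the surface it fills; [diagram] requires    *)
(* that surface to be the sphere.                                              *)

Inductive level := Over | Under | Virtual.

Record passage := Passage { label : nat; kind : level; dir : bool }.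

Definition labels (w : seq passage) : seq nat := map label w.

Definition is_over (p : passage) : bool :=
  if kind p is Over then true else false.
Definition is_virtual (p : passage) : bool :=
  if kind p is Virtual then true else false.

Definition facing (k l : level) : bool :=
  match k, l with
  | Over, Under | Under, Over | Virtual, Virtual => true
  | _, _ => false
  end.

Definition wf (w : seq passage) : bool :=
  all (fun p => match [seq q <- w | label q == label p] with
                | [:: q; r] => (dir q != dir r) && facing (kind q) (kind r)
                | _ => false
                end) w.

Definition at_pos (w : seq passage) (i : 'I_(size w)) : passage :=
  tnth (in_tuple w) i.

Definition partner (w : seq passage) (i : 'I_(size w)) : 'I_(size w) :=
  odflt i [pick j | (j != i) && (label (at_pos j) == label (at_pos i))].

(* The dart (i, true) is the half-edge leaving the crossing at position i, and *)
(* (i, false) is the half-edge entering it.                                    *)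
Definition dart (w : seq passage) : finType := ('I_(size w) * bool)%type.

Definition edge (w : seq passage) (x : dart w) : dart w :=
  if x.2 then (ordS x.1, false) else (ord_pred x.1, true).

(* The next dart counterclockwise around the same crossing. *)
Definition turn (w : seq passage) (x : dart w) : dart w :=
  (partner x.1, if dir (at_pos x.1) then x.2 else ~~ x.2).

Definition faces (w : seq passage) : nat :=
  fcard (fun x : dart w => turn (edge x)) predT.

(* With n crossings, Euler's formula n - 2n + faces = 2 (the graph underlying  *)
(* a knot diagram is connected).                                               *)
Definition planar (w : seq passage) : bool :=
  nilp w || (faces w == ((size w)./2 + 2)%N).

Definition diagram (w : seq passage) : bool := wf w && planar w.

Definition classical_diagram (w : seq passage) : bool :=
  diagram w && ~~ has is_virtual w.

(* Equivalence.  Every move below is only used between two [diagram]s, so      *)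
(* labels on the two sides are automatically fresh, and a move that creates    *)
(* crossings is performed inside a face of the smaller diagram.                *)

Inductive isotopy : seq passage -> seq passage -> Prop :=
| Rebase n w : isotopy w (rot n w)
| Relabel (f : nat -> nat) w : injective f ->
    isotopy w [seq Passage (f (label p)) (kind p) (dir p) | p <- w].

(* The two passages through a classical crossing c of sign s (true for +1). *)
Definition ov (c : nat) (s : bool) : passage := Passage c Over s.
Definition un (c : nat) (s : bool) : passage := Passage c Under (~~ s).

Definition ord2 (o : bool) (p q : passage) : seq passage :=
  if o then [:: p; q] else [:: q; p].

(* In the third move the top, middle and bottom strands cross at x (top over   *)
(* middle), y (top over bottom) and z (middle over bottom).  The booleans      *)
(* o1, o2, o3 are the orders in which the strands meet their two crossings.    *)
(* The three edges involved bound a triangular face exactly when               *)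
(* sx o1 o2 = sy o1 o3 = sz o2 o3 as products of signs, the common value being *)
(* the orientation of the triangle xyz.                                        *)
Inductive reidemeister : seq passage -> seq passage -> Prop :=
| R1 u1 u2 c s o :
    reidemeister (u1 ++ ord2 o (ov c s) (un c s) ++ u2) (u1 ++ u2)
| R2 u1 u2 u3 a b s o :
    reidemeister
      (u1 ++ [:: ov a s; ov b (~~ s)] ++ u2 ++ ord2 o (un a s) (un b (~~ s))
          ++ u3)
      (u1 ++ u2 ++ u3)
| R3_tmb u1 u2 u3 u4 x y z sx sy sz o1 o2 o3 :
    sx (+) o1 (+) o2 = sy (+) o1 (+) o3 ->
    sx (+) o1 (+) o2 = sz (+) o2 (+) o3 ->
    reidemeister
      (u1 ++ ord2 o1 (ov x sx) (ov y sy) ++ u2 ++ ord2 o2 (un x sx) (ov z sz)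
          ++ u3 ++ ord2 o3 (un y sy) (un z sz) ++ u4)
      (u1 ++ ord2 (~~ o1) (ov x sx) (ov y sy)
          ++ u2 ++ ord2 (~~ o2) (un x sx) (ov z sz)
          ++ u3 ++ ord2 (~~ o3) (un y sy) (un z sz) ++ u4)
| R3_tbm u1 u2 u3 u4 x y z sx sy sz o1 o2 o3 :
    sx (+) o1 (+) o2 = sy (+) o1 (+) o3 ->
    sx (+) o1 (+) o2 = sz (+) o2 (+) o3 ->
    reidemeister
      (u1 ++ ord2 o1 (ov x sx) (ov y sy) ++ u2 ++ ord2 o3 (un y sy) (un z sz)
          ++ u3 ++ ord2 o2 (un x sx) (ov z sz) ++ u4)
      (u1 ++ ord2 (~~ o1) (ov x sx) (ov y sy)
          ++ u2 ++ ord2 (~~ o3) (un y sy) (un z sz)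
          ++ u3 ++ ord2 (~~ o2) (un x sx) (ov z sz) ++ u4).

(* What remains of the rest u of the diagram when the arc a is deleted. *)
Definition erase_arc (a u : seq passage) : seq passage :=
  [seq p <- u | label p \notin labels a].

Inductive detour : seq passage -> seq passage -> Prop :=
| Detour a u a' u' :
    all is_virtual a -> all is_virtual a' ->
    erase_arc a u = erase_arc a' u' ->
    detour (a ++ u) (a' ++ u').

Definition classical_equiv : seq passage -> seq passage -> Prop :=
  clos_refl_sym_trans _ (fun w w' =>
    [/\ classical_diagram w, classical_diagram w'
      & isotopy w w' \/ reidemeister w w']).

Definition virtual_equiv : seq passage -> seq passage -> Prop :=
  clos_refl_sym_trans _ (fun w w' =>
    [/\ diagram w, diagram w'
      & [\/ isotopy w w', reidemeister w w' | detour w w']]).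

Definition non_classical (w : seq passage) : Prop :=
  forall w', classical_diagram w' -> ~ virtual_equiv w w'.

Definition non_trivial (w : seq passage) : Prop := ~ virtual_equiv w [::].

Definition unknot (w : seq passage) : Prop := classical_equiv w [::].

(* Crossing changes and virtualization. *)

Definition flip (k : level) : level :=
  match k with Over => Under | Under => Over | Virtual => Virtual end.

Definition switch (cs : seq nat) (w : seq passage) : seq passage :=
  [seq if label p \in cs then Passage (label p) (flip (kind p)) (dir p) else p
  | p <- w].

Definition unknotted_by (n : nat) (w : seq passage) : Prop :=
  exists (w' : seq passage) (cs : seq nat),
    [/\ classical_equiv w w', uniq cs, {subset cs <= labels w'},
        size cs = n & unknot (switch cs w')].

Definition unknotting_number (w : seq passage) (n : nat) : Prop :=
  unknotted_by n w /\ forall m, unknotted_by m w -> (n <= m)%N.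

(* The two virtual crossings a and b have the planar shape of the original     *)
(* crossing, whose disk they share with v.  Each strand keeps its level at v   *)
(* but now runs through v from the opposite side, so that the crossing seen in *)
(* the plane is the switched one.  If [anti] is false the two strands meet a,  *)
(* v, b in the same order; if it is true they meet them in opposite orders:    *)
(* the two directions in which the virtual crossings can flank v.              *)
Definition flank (a b : nat) (anti : bool) (p : passage) : seq passage :=
  let: (x, y) := if anti && ~~ is_over p then (b, a) else (a, b) in
  [:: Passage x Virtual (dir p); Passage (label p) (kind p) (~~ dir p);
      Passage y Virtual (dir p)].

Definition virtualization (v : nat) (w w' : seq passage) : Prop :=
  exists (a b : nat) (anti : bool),
    [/\ a \notin labels w, b \notin labels w, a != b
      & w' = flatten [seq if label p == v then flank a b anti p else [:: p]
                     | p <- w]].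

(* The Jones polynomial, by the Kauffman bracket state sum, as an element of   *)
(* the field Q(t^(1/4)), where t^(1/4) is 'X and A = t^(-1/4).                 *)

Definition varA : {fraction {poly int}} := (tofrac ('X : {poly int}))^-1.

Definition overs (w : seq passage) : {set 'I_(size w)} :=
  [set i | is_over (at_pos i)].

Definition over_pos (w : seq passage) (i : 'I_(size w)) : 'I_(size w) :=
  if is_over (at_pos i) then i else partner i.

(* A state S is the set of over-passages of the A-smoothed crossings.  The     *)
(* A-smoothing respects orientations iff the crossing is positive; a smoothing *)
(* that does so joins incoming to outgoing darts, the other one does not.      *)
Definition smooth (w : seq passage) (S : {set 'I_(size w)}) (x : dart w) :
    dart w :=
  if is_virtual (at_pos x.1) then (x.1, ~~ x.2)
  else if (over_pos x.1 \in S) == dir (at_pos (over_pos x.1))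
  then (partner x.1, ~~ x.2) else (partner x.1, x.2).

Definition loops (w : seq passage) (S : {set 'I_(size w)}) : nat :=
  n_comp (fun x y : dart w => (y == edge x) || (y == smooth S x)) predT.

(* On [::] the only state has no darts; it stands for one loop, and the        *)
(* truncated predecessor gives the bracket its value 1.                        *)
Definition bracket (w : seq passage) : {fraction {poly int}} :=
  \sum_(S in powerset (overs w))
    varA ^ (#|S|%:Z - #|overs w :\: S|%:Z)
    * (- varA ^+ 2 - varA ^- 2) ^+ (loops S).-1.

Definition writhe (w : seq passage) : int :=
  \sum_(i in overs w) (if dir (at_pos i) then 1 else -1).

Definition jones (w : seq passage) : {fraction {poly int}} :=
  (- varA ^+ 3) ^ (- writhe w) * bracket w.

(* Main.v *)
(* A planar diagram of a classical knot carries an Alexander numbering of its edges.  On Gauss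
   codes, consider the state sum over colourings of the edges by integers modulo an odd prime
   [p = - A^2 - A^-2], where an orientation-preserving smoothing identifies colours and an
   orientation-reversing one makes the colours of the two strands differ by a twist [g].  It is
   invariant under all moves of virtual knots.  For [g = 0] it is [p] times the Jones polynomial
   at [A]; for [g = 1] it is a shadow of the arrow polynomial.  On a classical diagram, shifting
   the colours by the Alexander numbering shows that the value does not depend on [g].

   Assume that [Kv] is equivalent to a classical diagram.  Shifting the colours of [Kv] by the
   numbering of [K] removes the twist everywhere except at [v], where a twist by 2 remains when
   the smoothing reverses orientations.  Write [X] and [Y] for the sums over the states of [K]
   with [v] smoothed with and against the orientations, and [Y2] for the sum [Y] with a twist by
   2 at [v].  Invariance gives [Y = Y2].  A checkerboard colouring orients the loops of all states
   coherently, so that states are permutations of the edges and the two smoothings of [v] differ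
   by a transposition; state by state this gives [p X = Y + (p^2 - 1) Y2].  Hence [X = p Y], and
   both [K] and the unknot [Ks] have the invariant [Y].  So the Jones polynomial of [K] is 1 at
   infinitely many points. *)
Require Import Defs.
From Stdlib Require Import FunctionalExtensionality Relations.Relation_Operators.
From mathcomp Require Import all_boot all_order all_fingroup all_algebra algC.
From mathcomp Require Import zify ring.

Set Implicit Arguments.
Unset Strict Implicit.
Unset Printing Implicit Defensive.

Import GRing.Theory Num.Theory.
Local Open Scope ring_scope.

(** * Crossing weights *)

Section LocalWeights.

Variables (R : fieldType) (A : R) (n : nat).
Local Notation C := 'I_n.+2.
Hypothesis A_neq0 : A != 0.
Hypothesis A_loop : n.+2%:R = - A ^+ 2 - A ^- 2.

Definition kron (a b : C) : R := (a == b)%:R.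
Definition coef (s : bool) : R := if s then A else A^-1.
Definition kink (s : bool) : R := - coef s ^+ 3.
Definition signed (g : C) (s : bool) : C := if s then g else - g.

Definition bracket_wt (s : bool) (p q : C * C) : R :=
  coef s * (kron p.1 q.2 * kron q.1 p.2) + coef (~~ s) * (kron p.1 q.1 * kron p.2 q.2).

(* [p] and [q] are the colours of the incoming and outgoing edges of the over- and of the
   under-strand.  The factor [kink] normalises by the writhe. *)
Definition cross_wt (g : C) (s : bool) (p q : C * C) : R :=
  (kink s)^-1 * (coef s * (kron p.1 q.2 * kron q.1 p.2)
    + coef (~~ s) * (kron q.1 (p.1 + signed g s) * kron p.2 (q.2 + signed g s))).

Lemma coef_neq0 s : coef s != 0.
Proof. by case: s; rewrite /= ?invr_eq0. Qed.

Lemma kink_neq0 s : kink s != 0.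
Proof. by rewrite oppr_eq0 expf_neq0 // coef_neq0. Qed.

Lemma kronC a b : kron a b = kron b a.
Proof. by rewrite /kron eq_sym. Qed.

Lemma kronD a b c : kron (a + c) (b + c) = kron a b.
Proof. by rewrite /kron (inj_eq (addIr c)). Qed.

Lemma sum_kron (a : C) (F : C -> R) : \sum_x kron x a * F x = F a.
Proof.
rewrite (bigD1 a) //= /kron eqxx mul1r big1 ?addr0 // => x /negbTE->.
by rewrite mul0r.
Qed.

Lemma sum_kronxx : \sum_x kron x x = n.+2%:R.
Proof. by under eq_bigr do rewrite /kron eqxx; rewrite sumr_const card_ord. Qed.

Lemma cross0 s p q : cross_wt 0 s p q = (kink s)^-1 * bracket_wt s p q.
Proof. by rewrite /cross_wt /bracket_wt /signed oppr0 if_same !addr0 (kronC q.1 p.1). Qed.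

(** A single crossing has a local Alexander numbering, with the value [a] on two of its ends and
    [a + signed g s] on the other two. The oriented smoothing joins ends with equal values, and the
    jump between the strands absorbs the twist of the other smoothing. *)
Lemma cross_gauge g s a p q :
  cross_wt g s (p.1 + a, p.2 + (a + signed g s)) (q.1 + (a + signed g s), q.2 + a)
  = cross_wt 0 s p q.
Proof. by rewrite cross0 /cross_wt /bracket_wt /= -!addrA !kronD (kronC q.1 p.1). Qed.

Lemma coefV s : coef (~~ s) = (coef s)^-1.
Proof. by case: s; rewrite /= ?invrK. Qed.

Lemma loop_coef s : n.+2%:R = - coef s ^+ 2 - coef s ^- 2.
Proof. by rewrite A_loop; case: s => //=; rewrite !exprVn invrK addrC. Qed.

(** One smoothing of a curl splits off a loop, worth [n.+2], and the other does not; the loop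
    relation turns the sum into the usual factor of the Kauffman bracket under the first move. *)
Lemma kinkE s : coef s * n.+2%:R + coef (~~ s) = kink s.
Proof. by rewrite (loop_coef s) /kink coefV; field; rewrite coef_neq0. Qed.

Lemma cross_R1_over g s p0 p2 : \sum_p1 cross_wt g s (p0, p1) (p1, p2) = kron p0 p2.
Proof.
rewrite -big_distrr /= big_split /= -!big_distrr /=.
apply: (mulfI (kink_neq0 s)); rewrite mulVKf ?kink_neq0 // -kinkE.
rewrite sum_kronxx sum_kron kronD; ring.
Qed.

Lemma cross_R1_under g s q0 q2 : \sum_q1 cross_wt g s (q1, q2) (q0, q1) = kron q0 q2.
Proof.
rewrite -big_distrr /= big_split /= -!big_distrr /=.
apply: (mulfI (kink_neq0 s)); rewrite mulVKf ?kink_neq0 // -kinkE.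
under [X in _ + _ * X]eq_bigr => x _ do
  rewrite /= (kronC q0) -(kronD _ q0 (- signed g s)) addrK.
rewrite sum_kron addrNK -big_distrl /= sum_kronxx (kronC q2); ring.
Qed.

(** Reversing one strand exchanges the two smoothings, hence amounts to a change of sign. *)
Lemma bracket_rev_over s p q : bracket_wt (~~ s) p q = bracket_wt s (p.2, p.1) q.
Proof.
by rewrite /bracket_wt negbK /= !(kronC q.1); ring.
Qed.

Lemma bracket_rev_under s p q : bracket_wt (~~ s) p q = bracket_wt s p (q.2, q.1).
Proof. by rewrite /bracket_wt negbK /= addrC (kronC p.2) (kronC q.1). Qed.

Lemma sum2_kron (a : C) (f : C -> C) (F : C -> C -> R) :
  \sum_x \sum_y kron x a * kron y (f x) * F x y = F a (f a).
Proof.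
under eq_bigr do (under eq_bigr do rewrite -mulrA; rewrite -big_distrr /= sum_kron).
by rewrite sum_kron.
Qed.

Lemma sum3_kron (a : C) (f : C -> C) (h : C -> C -> C) (F : C -> C -> C -> R) :
  \sum_x \sum_y \sum_z kron x a * kron y (f x) * kron z (h x y) * F x y z
  = F a (f a) (h a (f a)).
Proof.
under eq_bigr do under eq_bigr do
  (under eq_bigr do rewrite -mulrA; rewrite -big_distrr /= sum_kron).
by rewrite sum2_kron.
Qed.

Lemma bracket_R2 s p0 p2 q0 q2 :
  \sum_p1 \sum_q1 bracket_wt s (p0, p1) (q0, q1) * bracket_wt (~~ s) (p1, p2) (q1, q2)
  = kron p0 p2 * kron q0 q2.
Proof.
(* The four states. In the first three the leading factors determine [p1] and [q1]; the last
   contains a closed loop. All but the first cancel by the loop relation. *)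
have e p1 q1 : bracket_wt s (p0, p1) (q0, q1) * bracket_wt (~~ s) (p1, p2) (q1, q2) =
  kron p1 q0 * kron q1 p0 * (kron p1 q2 * kron q1 p2)
  + kron p1 q0 * kron q1 p0 * (coef s ^+ 2 * kron p1 q1 * kron p2 q2)
  + kron p1 q2 * kron q1 p2 * (coef s ^- 2 * kron p0 q0 * kron p1 q1)
  + kron q1 p1 * (kron p1 q1 * kron p0 q0 * kron p2 q2).
  rewrite /bracket_wt /= negbK coefV (kronC p0 q1) (kronC q0 p1) (kronC q1 p1).
  field; exact: coef_neq0.
under eq_bigr do under eq_bigr do rewrite e.
under eq_bigr do rewrite !big_split /= sum_kron.
rewrite !big_split /= !sum2_kron.
under [X in _ + X]eq_bigr do rewrite -mulrA.
rewrite -big_distrl /= sum_kronxx (loop_coef s).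
rewrite (kronC q0 p0) (kronC q2 p2); ring.
Qed.

(** The ends of a strand at one of two consecutive crossings, [t1] being the colour between them. As
    [~~ o] selects the other crossing, one boolean encodes the order in which a strand meets its
    crossings. *)
Definition segment (o : bool) (t0 t1 t2 : C) : C * C :=
  if o then (t0, t1) else (t1, t2).

Lemma sum3_kron_rev (a : C) (f : C -> C) (h : C -> C -> C) (F : C -> C -> C -> R) :
  \sum_x \sum_y \sum_z kron z a * kron y (f z) * kron x (h y z) * F x y z
  = F (h (f a) a) (f a) a.
Proof.
rewrite -(sum3_kron a f (fun z y => h y z) (fun z y x => F x y z)).
under eq_bigr do rewrite exchange_big /=.
rewrite exchange_big /=; apply: eq_bigr => z _; exact: exchange_big.
Qed.

Lemma sum3_loop :
  \sum_x \sum_y \sum_z kron y x * kron z x * kron y z = n.+2%:R.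
Proof.
by under eq_bigr do rewrite sum2_kron; exact: sum_kronxx.
Qed.

Lemma bracket_R3_coherent s t0 t2 m0 m2 b0 b2 :
  \sum_t1 \sum_m1 \sum_b1 bracket_wt s (t0, t1) (m0, m1) *
    bracket_wt s (t1, t2) (b0, b1) * bracket_wt s (m1, m2) (b1, b2) =
  \sum_t1 \sum_m1 \sum_b1 bracket_wt s (t1, t2) (m1, m2) *
    bracket_wt s (t0, t1) (b1, b2) * bracket_wt s (m0, m1) (b0, b1).
Proof.
pose a := coef s; pose a' := (coef s)^-1.
(* The eight states of the triangle. Seven of them determine the inner colours; the last closes the
   triangle into a loop, whose value makes both sides agree. *)
have eL t m b : bracket_wt s (t0, t) (m0, m) *
    bracket_wt s (t, t2) (b0, b) * bracket_wt s (m, m2) (b, b2) =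
  kron t m0 * kron m t0 * kron b m2 * (a ^+ 3 * kron b0 t2 * kron t b * kron m b2)
  + kron t m0 * kron m t0 * kron b t * (a * kron b0 t2 * kron m2 b2 * kron m b)
  + kron t m0 * kron m t0 * kron b t2 * (a * kron t b0 * kron m b2 * kron b m2)
  + kron t m0 * kron m t0 * kron b t2 * (a' * kron t b0 * kron m b * kron m2 b2)
  + kron b m2 * kron m b2 * kron t m * (a * kron m0 t0 * kron b0 t2 * kron t b)
  + kron t b0 * kron m t * kron b t2 * (a' * kron m0 t0 * kron m b2 * kron b m2)
  + kron t b0 * kron m t * kron b t2 * (a' ^+ 3 * kron m0 t0 * kron m b * kron m2 b2)
  + a' * kron m0 t0 * kron b0 t2 * kron m2 b2 * (kron m t * kron b t * kron m b).
  rewrite /bracket_wt /= coefV (kronC t0 m) (kronC t0 m0) (kronC m0 t) (kronC t2 b).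
  rewrite (kronC t m) (kronC b t) /a' /a.
  field; exact: coef_neq0.
have eR t m b : bracket_wt s (t, t2) (m, m2) *
    bracket_wt s (t0, t) (b, b2) * bracket_wt s (m0, m) (b0, b) =
  kron t m2 * kron m t2 * kron b t * (a ^+ 3 * kron t0 b2 * kron m0 b * kron b0 m)
  + kron t m2 * kron m t2 * kron b t * (a * kron t0 b2 * kron m0 b0 * kron m b)
  + kron t m2 * kron m t2 * kron b t0 * (a * kron t b2 * kron m0 b * kron b0 m)
  + kron t m2 * kron m t2 * kron b t0 * (a' * kron t b2 * kron m0 b0 * kron m b)
  + kron b m0 * kron m b0 * kron t m * (a * kron t2 m2 * kron t0 b2 * kron t b)
  + kron t b2 * kron m t * kron b t0 * (a' * kron t2 m2 * kron m0 b * kron b0 m)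
  + kron t b2 * kron m t * kron b t0 * (a' ^+ 3 * kron t2 m2 * kron m0 b0 * kron m b)
  + a' * kron t2 m2 * kron t0 b2 * kron m0 b0 * (kron m t * kron b t * kron m b).
  rewrite /bracket_wt /= coefV (kronC t0 b) (kronC t m) (kronC t b) (kronC m0 b).
  rewrite (kronC b t) (kronC b0 m) /a' /a.
  field; exact: coef_neq0.
under eq_bigr do under eq_bigr do
  (under eq_bigr do rewrite eL; rewrite !big_split /=).
under [in RHS]eq_bigr do under eq_bigr do
  (under eq_bigr do rewrite eR; rewrite !big_split /=).
under eq_bigr do rewrite !big_split /=.
under [in RHS]eq_bigr do rewrite !big_split /=.
rewrite !big_split /= !sum3_kron !sum3_kron_rev.
under [X in _ + X = _]eq_bigr do (under eq_bigr do rewrite -big_distrr /=;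
  rewrite -big_distrr /=).
under [X in _ = _ + X]eq_bigr do (under eq_bigr do rewrite -big_distrr /=;
  rewrite -big_distrr /=).
rewrite -!big_distrr /= sum3_loop (loop_coef s).
rewrite /a' /a.
rewrite (kronC t0 m0) (kronC b2 m2) (kronC t2 t0) (kronC b0 m0) (kronC b2 t0).
field; exact: coef_neq0.
Qed.

(** Reversing strands reduces every case to the coherent one: a reversal swaps the end colours of
    the strand and flips the signs of its two crossings, which the exclusive ors record. *)
Lemma bracket_R3 s o1 o2 o3 t0 t2 m0 m2 b0 b2 :
  \sum_t1 \sum_m1 \sum_b1
    bracket_wt (s (+) o1 (+) o2) (segment o1 t0 t1 t2) (segment o2 m0 m1 m2) *
    bracket_wt (s (+) o1 (+) o3) (segment (~~ o1) t0 t1 t2) (segment o3 b0 b1 b2) *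
    bracket_wt (s (+) o2 (+) o3) (segment (~~ o2) m0 m1 m2) (segment (~~ o3) b0 b1 b2) =
  \sum_t1 \sum_m1 \sum_b1
    bracket_wt (s (+) o1 (+) o2) (segment (~~ o1) t0 t1 t2) (segment (~~ o2) m0 m1 m2) *
    bracket_wt (s (+) o1 (+) o3) (segment o1 t0 t1 t2) (segment (~~ o3) b0 b1 b2) *
    bracket_wt (s (+) o2 (+) o3) (segment o2 m0 m1 m2) (segment o3 b0 b1 b2).
Proof.
pose rev (o : bool) (t t' : C) := if o then t else t'.
have := bracket_R3_coherent s (rev o1 t0 t2) (rev o1 t2 t0) (rev o2 m0 m2)
  (rev o2 m2 m0) (rev o3 b0 b2) (rev o3 b2 b0).
have bracket_rev u p q : bracket_wt u p q = bracket_wt u (p.2, p.1) (q.2, q.1).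
  by rewrite -bracket_rev_over bracket_rev_under; case: q.
move=> e.
have E u (o o' : bool) (t t1 t' v v1 v' : C) (b c : bool) :
  bracket_wt (u (+) o (+) o') (segment (b (+) ~~ o) t t1 t') (segment (c (+) ~~ o') v v1 v')
  = bracket_wt u (segment b (rev o t t') t1 (rev o t' t))
      (segment c (rev o' v v') v1 (rev o' v' v)).
  case: o o' b c => [] [] [] []; rewrite /= ?addbT ?addbF ?negbK //;
    by rewrite ?bracket_rev_over ?bracket_rev_under // bracket_rev.
pose B1 x y t m := bracket_wt s (segment x (rev o1 t0 t2) t (rev o1 t2 t0))
  (segment y (rev o2 m0 m2) m (rev o2 m2 m0)).
pose B2 x y t b := bracket_wt s (segment x (rev o1 t0 t2) t (rev o1 t2 t0))
  (segment y (rev o3 b0 b2) b (rev o3 b2 b0)).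
pose B3 x y m b := bracket_wt s (segment x (rev o2 m0 m2) m (rev o2 m2 m0))
  (segment y (rev o3 b0 b2) b (rev o3 b2 b0)).
transitivity (\sum_t1 \sum_m1 \sum_b1
  B1 true true t1 m1 * B2 false true t1 b1 * B3 false false m1 b1).
  apply: eq_bigr => t _; apply: eq_bigr => m _; apply: eq_bigr => b _.
  by rewrite /B1 /B2 /B3 -!E /= !negbK.
rewrite [LHS]e; apply: eq_bigr => t _; apply: eq_bigr => m _.
apply: eq_bigr => b _; symmetry.
rewrite -[RHS]/(B1 false false t m * B2 true false t b * B3 true true m b).
by rewrite /B1 /B2 /B3 -!E /= !negbK.
Qed.

Lemma sum_shift (a : C) (F : C -> R) : \sum_x F x = \sum_x F (x + a).
Proof. exact/reindex_inj/addIr. Qed.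

(* The values of an Alexander numbering around a crossing, scaled by [g]. *)
Definition fits (g : C) s (p q : C * C) :=
  [/\ p.2 = p.1 + signed g s, q.1 = p.1 + signed g s & q.2 = p.1].

Lemma cross_fits g s p q p' q' :
  fits g s p' q' -> cross_wt g s (p + p') (q + q') = cross_wt 0 s p q.
Proof.
case: p' q' => [a b] [c d] [/= -> -> ->]; rewrite -(cross_gauge g s a).
by case: p q => [? ?] [? ?].
Qed.

Lemma signed_neg g s : signed g (~~ s) = - signed g s.
Proof. by case: s; rewrite /= ?opprK. Qed.

Lemma kinkM s : kink s * kink (~~ s) = 1.
Proof. by rewrite /kink coefV; field; exact: coef_neq0. Qed.

Lemma cross0_R2 s p q p' q' :
  cross_wt 0 s p q * cross_wt 0 (~~ s) p' q' = bracket_wt s p q * bracket_wt (~~ s) p' q'.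
Proof. by rewrite !cross0 mulrACA -invfM kinkM invr1 mul1r. Qed.

Lemma add_pair (a b c d : C) : (a, b) + (c, d) = (a + c, b + d).
Proof. by []. Qed.

(** The bigon carries a local numbering, [0, e, 0] along the over-strand and [e, 0, e] along the
    under-strand. Shifting by it removes both twists and leaves the bracket identity. *)
Lemma cross_R2 g s p0 p2 q0 q2 :
  \sum_p1 \sum_q1 cross_wt g s (p0, p1) (q0, q1) * cross_wt g (~~ s) (p1, p2) (q1, q2)
  = kron p0 p2 * kron q0 q2.
Proof.
set e := signed g s; rewrite -[q0](subrK e) -[q2](subrK e) kronD.
set q0' := q0 - e; set q2' := q2 - e.
rewrite -(bracket_R2 s) (sum_shift e).
apply: eq_bigr => p1 _; apply: eq_bigr => q1 _; rewrite -cross0_R2.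
rewrite -[in RHS](@cross_fits g s _ _ (0, e) (e, 0)); last first.
  by split; rewrite //= add0r.
rewrite -[X in _ = _ * X](@cross_fits g (~~ s) _ _ (e, 0) (0, e)); last first.
  by split; rewrite //= signed_neg subrr.
by rewrite !add_pair !addr0.
Qed.

(** For antiparallel strands the numbering is [0, e, 0] along both; reversing the under-strand leads
    back to the parallel bracket identity. *)
Lemma cross_R2_rev g s p0 p2 q0 q2 :
  \sum_p1 \sum_q1 cross_wt g s (p0, p1) (q1, q2) * cross_wt g (~~ s) (p1, p2) (q0, q1)
  = kron p0 p2 * kron q0 q2.
Proof.
set e := signed g s; rewrite (kronC q0) -(bracket_R2 (~~ s)) (sum_shift e).
apply: eq_bigr => p1 _; rewrite (sum_shift e); apply: eq_bigr => q1 _.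
rewrite bracket_rev_under bracket_rev_under -cross0_R2.
rewrite -[in RHS](@cross_fits g s _ _ (0, e) (e, 0)); last first.
  by split; rewrite //= add0r.
rewrite -[X in _ = _ * X](@cross_fits g (~~ s) _ _ (e, 0) (0, e)); last first.
  by split; rewrite //= signed_neg subrr.
by rewrite !add_pair !addr0.
Qed.

Lemma cross_R3_gauge g s1 s2 s3 o1 o2 o3 (T0 T1 T2 M0 M1 M2 B0 B1 B2 : C)
    t0 t2 m0 m2 b0 b2 :
  fits g s1 (segment o1 T0 T1 T2) (segment o2 M0 M1 M2) ->
  fits g s2 (segment (~~ o1) T0 T1 T2) (segment o3 B0 B1 B2) ->
  fits g s3 (segment (~~ o2) M0 M1 M2) (segment (~~ o3) B0 B1 B2) ->
  \sum_t1 \sum_m1 \sum_b1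
    cross_wt g s1 (segment o1 (t0 + T0) t1 (t2 + T2)) (segment o2 (m0 + M0) m1 (m2 + M2)) *
    cross_wt g s2 (segment (~~ o1) (t0 + T0) t1 (t2 + T2)) (segment o3 (b0 + B0) b1 (b2 + B2)) *
    cross_wt g s3 (segment (~~ o2) (m0 + M0) m1 (m2 + M2))
      (segment (~~ o3) (b0 + B0) b1 (b2 + B2)) =
  (kink s1)^-1 * (kink s2)^-1 * (kink s3)^-1 *
  \sum_t1 \sum_m1 \sum_b1
    bracket_wt s1 (segment o1 t0 t1 t2) (segment o2 m0 m1 m2) *
    bracket_wt s2 (segment (~~ o1) t0 t1 t2) (segment o3 b0 b1 b2) *
    bracket_wt s3 (segment (~~ o2) m0 m1 m2) (segment (~~ o3) b0 b1 b2).
Proof.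
move=> f1 f2 f3.
have segmentD o (x0 x1 x2 y0 y1 y2 : C) : segment o (x0 + y0) (x1 + y1) (x2 + y2) =
  segment o x0 x1 x2 + segment o y0 y1 y2 by case: o.
rewrite (sum_shift T1) big_distrr; apply: eq_bigr => t _ /=.
rewrite (sum_shift M1) big_distrr; apply: eq_bigr => m _ /=.
rewrite (sum_shift B1) big_distrr; apply: eq_bigr => b _ /=.
rewrite !segmentD !cross_fits // !cross0; ring.
Qed.

Definition cross_triangle g s1 s2 s3 o1 o2 o3 t0 t2 m0 m2 b0 b2 : R :=
  \sum_t1 \sum_m1 \sum_b1
    cross_wt g s1 (segment o1 t0 t1 t2) (segment o2 m0 m1 m2) *
    cross_wt g s2 (segment (~~ o1) t0 t1 t2) (segment o3 b0 b1 b2) *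
    cross_wt g s3 (segment (~~ o2) m0 m1 m2) (segment (~~ o3) b0 b1 b2).

Lemma cross_R3 g s o1 o2 o3 t0 t2 m0 m2 b0 b2 :
  let s1 := s (+) o1 (+) o2 in
  let s2 := s (+) o1 (+) o3 in
  let s3 := s (+) o2 (+) o3 in
  cross_triangle g s1 s2 s3 o1 o2 o3 t0 t2 m0 m2 b0 b2 =
  cross_triangle g s1 s2 s3 (~~ o1) (~~ o2) (~~ o3) t0 t2 m0 m2 b0 b2.
Proof.
move=> s1 s2 s3.
(* A numbering of the six outer ends, starting from 0 on the incoming top strand. [ax] and [ay] are
   its values where the top strand enters its crossings with the middle and the bottom strand. The
   relation between the signs makes it fit at the third crossing too, before and after the move. *)
pose e1 := signed g s1; pose e2 := signed g s2; pose e3 := signed g s3.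
pose ax := if o1 then 0 else e2; pose ay := if o1 then e1 else 0.
pose T2 := e1 + e2.
pose M0 := if o2 then ax + e1 else ax + e1 - e3.
pose M2 := M0 - e1 + e3.
pose B0 := if o3 then ay + e2 else ay + e2 + e3.
pose B2 := B0 - e2 - e3.
rewrite /cross_triangle -[t0](subrK 0) -[t2](subrK T2) -[m0](subrK M0).
rewrite -[m2](subrK M2) -[b0](subrK B0) -[b2](subrK B2).
rewrite (@cross_R3_gauge _ _ _ _ _ _ _ _ (if o1 then e1 else e2) _ _
  (if o2 then M0 - e1 else M0 + e3) _ _ (if o3 then B0 - e2 else B0 - e3)).
rewrite (@cross_R3_gauge _ _ _ _ _ _ _ _ (if o1 then e2 else e1) _ _
  (if o2 then M0 + e3 else M0 - e1) _ _ (if o3 then B0 - e3 else B0 - e2)).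
by rewrite bracket_R3 !negbK.
all: rewrite /B2 /B0 /M2 /M0 /T2 /ax /ay /e1 /e2 /e3 /s1 /s2 /s3;
  case: (s) (o1) (o2) (o3) => [] [] [] []; split=> /=; ring.
Qed.

End LocalWeights.

(** * State sums over colourings of Gauss codes *)

Section Sumout.

Variables (R : nmodType) (I : finType).

Definition update (y : nat -> I) (c : nat) (i : I) : nat -> I :=
  fun d => if d == c then i else y d.

Lemma update_same y c i : update y c i c = i.
Proof. by rewrite /update eqxx. Qed.

Lemma update_other y c i d : d != c -> update y c i d = y d.
Proof. by rewrite /update => /negbTE->. Qed.

Lemma updateC y c d i j : c != d -> update (update y c i) d j = update (update y d j) c i.
Proof.
move=> ncd; apply: functional_extensionality => e; rewrite /update.
by case: (eqVneq e d) => // ->; rewrite eq_sym (negbTE ncd).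
Qed.

(** Labels are arbitrary natural numbers, so the sum over colourings is iterated along a list of
    labels, to which a move adds or removes entries. *)
Fixpoint sumout (cs : seq nat) (F : (nat -> I) -> R) (y : nat -> I) : R :=
  if cs is c :: cs' then \sum_i sumout cs' F (update y c i) else F y.

Lemma eq_sumout cs F G y :
  (forall y, F y = G y) -> sumout cs F y = sumout cs G y.
Proof.
move=> eFG; elim: cs y => //= c cs IH y.
by apply: eq_bigr => i _; exact: IH.
Qed.

Lemma sumout_cat cs ds F y : sumout (cs ++ ds) F y = sumout cs (sumout ds F) y.
Proof. by elim: cs y => //= c cs IH y; apply: eq_bigr => i _. Qed.

Lemma sumout_swap c d cs F y :
  sumout [:: c, d & cs] F y = sumout [:: d, c & cs] F y.
Proof.
have [->//|ncd] := eqVneq c d.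
rewrite /= exchange_big; apply: eq_bigr => i _; apply: eq_bigr => j _.
by rewrite updateC.
Qed.

Lemma sumout_mid cs c ds F y : sumout (cs ++ c :: ds) F y = sumout (c :: cs ++ ds) F y.
Proof.
elim: cs y => // d cs IH y; rewrite [RHS]sumout_swap /=.
by apply: eq_bigr => i _; rewrite IH.
Qed.

Lemma perm_sumout cs ds F y : perm_eq cs ds -> sumout cs F y = sumout ds F y.
Proof.
elim: cs ds y => [|c cs IH] ds y; first by rewrite perm_sym => /perm_nilP->.
move=> eq_ds; have /path.splitPr : c \in ds by rewrite -(perm_mem eq_ds) mem_head.
move=> ds_split; case: ds_split eq_ds => ds1 ds2.
rewrite perm_sym -cat1s perm_catCA /= perm_cons perm_sym => eq_ds.
by rewrite sumout_mid /=; apply: eq_bigr => i _; exact: IH.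
Qed.

Lemma sumout_map (f : nat -> nat) cs F y : injective f ->
  sumout [seq f c | c <- cs] (fun y => F (y \o f)) y = sumout cs F (y \o f).
Proof.
move=> inj_f; elim: cs y => //= c cs IH y; apply: eq_bigr => i _.
rewrite IH; congr sumout; apply: functional_extensionality => d.
by rewrite /update /= (inj_eq inj_f).
Qed.

End Sumout.

Section Invariant.

Variables (R : fieldType) (A : R) (n : nat).
Local Notation C := 'I_n.+2.
Hypothesis A_neq0 : A != 0.
Hypothesis A_loop : n.+2%:R = - A ^+ 2 - A ^- 2.
Variable g : C.
Local Notation wt := (cross_wt A g).
Local Notation I := ((C * C) * (C * C))%type.

Definition pair_mx (p : C * C) : 'M[R]_n.+2 := delta_mx p.1 p.2.

Definition passage_mx (y : nat -> I) (p : passage) : 'M[R]_n.+2 :=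
  match kind p with
  | Over => pair_mx (y (label p)).1
  | Under => pair_mx (y (label p)).2
  | Virtual => 1
  end.

Definition passage_wt (y : nat -> I) (p : passage) : R :=
  if is_over p then wt (dir p) (y (label p)).1 (y (label p)).2 else 1.

Definition word_mx (y : nat -> I) (w : seq passage) : 'M[R]_n.+2 :=
  \prod_(p <- w) passage_mx y p.

Definition word_wt (y : nat -> I) (w : seq passage) : R := \prod_(p <- w) passage_wt y p.

Definition value (y : nat -> I) (w : seq passage) : R := word_wt y w * \tr (word_mx y w).

Lemma word_mx_cat y u v : word_mx y (u ++ v) = word_mx y u * word_mx y v.
Proof. exact: big_cat. Qed.

Lemma word_wt_cat y u v : word_wt y (u ++ v) = word_wt y u * word_wt y v.
Proof. exact: big_cat. Qed.

Definition crossings (w : seq passage) : seq nat :=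
  [seq label p | p <- w & is_over p].

(* The sum ranges over colourings [y] of the ends of all crossings.  The trace of the product of
   the elementary matrices of the passages tests that the two ends of each edge have the same
   colour, so that a move only changes a few consecutive factors. *)
Definition arrow_sum (w : seq passage) : R :=
  sumout (crossings w) (value ^~ w) (fun=> ((0, 0), (0, 0))).

Lemma arrow_sum_nil : arrow_sum [::] = n.+2%:R.
Proof. by rewrite /arrow_sum /= /value /word_wt /word_mx !big_nil mul1r mxtrace1. Qed.

(** A virtual passage contributes the identity matrix and the weight 1. *)
Lemma arrow_sum_filter w :
  arrow_sum [seq p <- w | ~~ is_virtual p] = arrow_sum w.
Proof.
rewrite /arrow_sum; have -> : crossings [seq p <- w | ~~ is_virtual p] = crossings w.
  rewrite /crossings -filter_predI; congr map; apply: eq_filter => p /=.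
  by rewrite /is_over /is_virtual; case: (kind p).
apply: eq_sumout => y; rewrite /value /word_wt /word_mx !big_filter.
have -> : \prod_(p <- w | ~~ is_virtual p) passage_mx y p = \prod_(p <- w) passage_mx y p.
  rewrite [LHS]big_mkcond; apply: eq_bigr => p _.
  by rewrite /passage_mx /is_virtual; case: (kind p).
congr (_ * _); rewrite [LHS]big_mkcond; apply: eq_bigr => p _.
by rewrite /passage_wt /is_over /is_virtual; case: (kind p).
Qed.

Lemma crossings_cat u v : crossings (u ++ v) = crossings u ++ crossings v.
Proof. by rewrite /crossings filter_cat map_cat. Qed.

Lemma labels_cat u v : labels (u ++ v) = labels u ++ labels v.
Proof. exact: map_cat. Qed.

(** This is the cyclicity of the trace. *)
Lemma arrow_sum_rot k w : arrow_sum (rot k w) = arrow_sum w.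
Proof.
rewrite /rot -[in RHS](cat_take_drop k w) /arrow_sum.
set u := take k w; set v := drop k w.
rewrite !crossings_cat (perm_sumout _ _ (permEl (perm_catC _ _))).
apply: eq_sumout => y; rewrite /value !word_mx_cat !word_wt_cat mxtrace_mulC.
by rewrite [X in X * _]mulrC.
Qed.

Lemma arrow_sum_relabel f w : injective f ->
  arrow_sum [seq Passage (f (label p)) (kind p) (dir p) | p <- w] = arrow_sum w.
Proof.
move=> inj_f; rewrite /arrow_sum.
rewrite -[RHS](sumout_map (crossings w) (value ^~ w)
  (fun=> ((0, 0), (0, 0))) inj_f).
have -> : crossings [seq Passage (f (label p)) (kind p) (dir p) | p <- w] =
    [seq f c | c <- crossings w].
  by rewrite /crossings filter_map -!map_comp.
by apply: eq_sumout => y; rewrite /value /word_wt /word_mx !big_map.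
Qed.

Lemma word_mx_update y c i u : c \notin labels u -> word_mx (update y c i) u = word_mx y u.
Proof.
rewrite /word_mx; elim: u => [|p u IH]; rewrite ?big_nil // !big_cons inE negb_or.
by case/andP=> nc /IH->; rewrite /passage_mx update_other // eq_sym.
Qed.

Lemma word_wt_update y c i u : c \notin labels u -> word_wt (update y c i) u = word_wt y u.
Proof.
rewrite /word_wt; elim: u => [|p u IH]; rewrite ?big_nil // !big_cons inE negb_or.
by case/andP=> nc /IH->; rewrite /passage_wt update_other // eq_sym.
Qed.

Lemma pair_mxM p q : pair_mx p * pair_mx q = kron R p.2 q.1 *: pair_mx (p.1, q.2).
Proof. by rewrite /pair_mx /kron -mulmxE mul_delta_mx_cond scaler_nat. Qed.

Lemma sum_pair_mx : \sum_a pair_mx (a, a) = 1.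
Proof. by rewrite -[1]/(1%:M) mx1_sum_delta. Qed.

Lemma wfP w c : wf w -> c \in labels w -> exists q r,
  [/\ [seq p <- w | label p == c] = [:: q; r], dir q != dir r
    & facing (kind q) (kind r)].
Proof.
pose Q c := match [seq q <- w | label q == c] with
  | [:: q; r] => (dir q != dir r) && facing (kind q) (kind r) | _ => false end.
have -> : wf w = all Q (labels w) by rewrite /labels all_map.
move=> /allP wf_w /wf_w; rewrite /Q; case: filter => [|q [|r []]] // /andP[? ?].
by exists q, r.
Qed.

Lemma wf_count w c : wf w -> c \in labels w -> count_mem c (labels w) = 2.
Proof.
move=> wf_w /(wfP wf_w)[q [r [e _ _]]].
by rewrite /labels count_map -size_filter (eq_filter (a2 := fun p => label p == c)) ?e.
Qed.

(** Every label occurs exactly twice. So the colours at a crossing involved in a move do not affect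
    the factors of the rest of the code. *)
Lemma wf_fresh w c cs : wf w -> perm_eq (labels w) ([:: c; c] ++ cs) -> c \notin cs.
Proof.
move=> wf_w e; have := wf_count wf_w (c := c).
rewrite (perm_mem e) mem_head (seq.permP e) => /(_ isT) /=; rewrite eqxx => -[].
by move/eqP; rewrite -leqn0 leqNgt -has_count has_pred1.
Qed.

Lemma sum_pair (V : nmodType) (F : C * C -> V) :
  \sum_p F p = \sum_a \sum_b F (a, b).
Proof. by rewrite pair_bigA; apply: eq_bigr => -[]. Qed.

Lemma sum_I (V : nmodType) (F : I -> V) : \sum_i F i = \sum_p \sum_q F (p, q).
Proof. by rewrite pair_bigA; apply: eq_bigr => -[]. Qed.

(** With [join_ends], this describes the product of the elementary matrices of two consecutive
    passages: a test that the inner ends agree, times the elementary matrix of the outer ends. [o]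
    tells whether [p] comes first. *)
Definition ends_meet (o : bool) (p q : C * C) : R :=
  if o then kron R p.2 q.1 else kron R q.2 p.1.

Definition join_ends (o : bool) (p q : C * C) : C * C :=
  if o then (p.1, q.2) else (q.1, p.2).

Lemma sum_chain (o : bool) (F : C * C -> C * C -> R) :
  \sum_p \sum_q ends_meet o p q * F p q =
  \sum_t \sum_t1 F (segment o t.1 t1 t.2) (segment (~~ o) t.1 t1 t.2).
Proof.
rewrite [RHS]sum_pair sum_pair; case: o; rewrite /ends_meet /=.
  under eq_bigr do under eq_bigr do
    (rewrite sum_pair exchange_big /=; under eq_bigr do
      (under eq_bigr do rewrite kronC; rewrite sum_kron)).
  by apply: eq_bigr => a _; rewrite exchange_big.
under eq_bigr do under eq_bigr do
  (rewrite sum_pair /=; under eq_bigr do rewrite sum_kron).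
under eq_bigr do rewrite exchange_big /=.
rewrite exchange_big /=; apply: eq_bigr => a _.
by rewrite exchange_big.
Qed.

Lemma word_mx_ord2 y o p q :
  word_mx y (ord2 o p q) =
  if o then passage_mx y p * passage_mx y q else passage_mx y q * passage_mx y p.
Proof. by rewrite /word_mx; case: o; rewrite !big_cons big_nil mulr1. Qed.

Lemma word_wt_ord2 y o p q : word_wt y (ord2 o p q) = passage_wt y p * passage_wt y q.
Proof. by rewrite /word_wt; case: o; rewrite !big_cons big_nil mulr1 // mulrC. Qed.

Lemma pair_mx_ord2 o p q :
  (if o then pair_mx p * pair_mx q else pair_mx q * pair_mx p) =
  ends_meet o p q *: pair_mx (join_ends o p q).
Proof. by case: o; rewrite pair_mxM. Qed.

Lemma segment_join o t t1 :
  join_ends o (segment o t.1 t1 t.2) (segment (~~ o) t.1 t1 t.2) = t.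
Proof. by case: o t => -[]. Qed.

Definition cut (o : bool) (t : C * C) (t1 : C) : C * C := segment o t.1 t1 t.2.

Lemma sum_chain2 o1 o2 (F : I -> I -> R) :
  \sum_i \sum_j ends_meet o1 i.1 j.1 * ends_meet o2 i.2 j.2 * F i j =
  \sum_t \sum_u \sum_t1 \sum_u1
    F (cut o1 t t1, cut o2 u u1) (cut (~~ o1) t t1, cut (~~ o2) u u1).
Proof.
under [RHS]eq_bigr do rewrite exchange_big /=.
rewrite -(sum_chain o1 (fun p q => \sum_u \sum_u1
  F (p, cut o2 u u1) (q, cut (~~ o2) u u1))).
rewrite sum_I; apply: eq_bigr => p _.
under eq_bigr do rewrite sum_I.
rewrite exchange_big; apply: eq_bigr => q _ /=.
rewrite -(sum_chain o2 (fun p' q' => F (p, p') (q, q'))) big_distrr.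
apply: eq_bigr => p' _; rewrite big_distrr; apply: eq_bigr => q' _ /=.
by rewrite !mulrA.
Qed.

Lemma sum_chain3 o1 o2 o3 (F : I -> I -> I -> R) :
  \sum_i \sum_j \sum_k
    ends_meet o1 i.1 j.1 * ends_meet o2 i.2 k.1 * ends_meet o3 j.2 k.2 * F i j k =
  \sum_t \sum_m \sum_b \sum_t1 \sum_m1 \sum_b1
    F (cut o1 t t1, cut o2 m m1) (cut (~~ o1) t t1, cut o3 b b1)
      (cut (~~ o2) m m1, cut (~~ o3) b b1).
Proof.
transitivity (\sum_t \sum_t1 \sum_m \sum_b \sum_m1 \sum_b1
    F (cut o1 t t1, cut o2 m m1) (cut (~~ o1) t t1, cut o3 b b1)
      (cut (~~ o2) m m1, cut (~~ o3) b b1)); last first.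
  apply: eq_bigr => t _; rewrite exchange_big; apply: eq_bigr => m _ /=.
  by rewrite exchange_big.
rewrite -(sum_chain o1 (fun p q => \sum_m \sum_b \sum_m1 \sum_b1
  F (p, cut o2 m m1) (q, cut o3 b b1) (cut (~~ o2) m m1, cut (~~ o3) b b1))).
rewrite sum_I; apply: eq_bigr => p _.
under eq_bigr do rewrite sum_I.
rewrite exchange_big; apply: eq_bigr => q _ /=.
rewrite -(sum_chain2 o2 o3 (fun i k => F (p, i.1) (q, i.2) k)).
rewrite (sum_I (fun i => \sum_j _)) big_distrr; apply: eq_bigr => p' _ /=.
rewrite big_distrr; apply: eq_bigr => q' _ /=.
by rewrite big_distrr; apply: eq_bigr => k _ /=; rewrite !mulrA.
Qed.

(** The matrices [pair_mx (a, a)] add up to the identity, so a strand that is left without crossings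
    disappears from the word. *)
Lemma sum_pair_mx_tr (B1 B2 : 'M[R]_n.+2) :
  \sum_t kron R t.1 t.2 * \tr (B1 * pair_mx t * B2) = \tr (B1 * B2).
Proof.
rewrite sum_pair exchange_big /=; under eq_bigr do rewrite sum_kron.
rewrite -raddf_sum -mulr_suml -mulr_sumr.
by rewrite sum_pair_mx mulr1.
Qed.

Lemma mxtrace_midZ k (B1 M B2 : 'M[R]_n.+2) :
  \tr (B1 * (k *: M) * B2) = k * \tr (B1 * M * B2).
Proof. by rewrite -!mulmxE -scalemxAr -scalemxAl mxtraceZ. Qed.

Lemma arrow_sum_R1 u1 u2 c s o :
  wf (u1 ++ ord2 o (ov c s) (un c s) ++ u2) ->
  arrow_sum (u1 ++ ord2 o (ov c s) (un c s) ++ u2) = arrow_sum (u1 ++ u2).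
Proof.
set w := u1 ++ _; move=> wf_w.
have /(wf_fresh wf_w) : perm_eq (labels w) ([:: c; c] ++ labels (u1 ++ u2)).
  by apply/seq.permP => a; rewrite /w !labels_cat !count_cat; case: (o) => /=; ring.
rewrite labels_cat mem_cat negb_or => /andP[nc1 nc2].
have e : perm_eq (crossings w) (crossings (u1 ++ u2) ++ [:: c]).
  apply/seq.permP => a; rewrite /w !crossings_cat !count_cat.
  by case: (o); rewrite /= /crossings /=; ring.
rewrite /arrow_sum (perm_sumout _ _ e) sumout_cat; apply: eq_sumout => y /=.
pose W := word_wt y (u1 ++ u2).
pose T (M : 'M[R]_n.+2) := \tr (word_mx y u1 * M * word_mx y u2).
transitivity (\sum_i ends_meet o i.1 i.2 * (wt s i.1 i.2 * W * T (pair_mx (join_ends o i.1 i.2)))).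
  apply: eq_bigr => i _.
  rewrite /value /w !word_mx_cat !word_wt_cat word_mx_ord2 word_wt_ord2.
  rewrite !(word_mx_update, word_wt_update) // /passage_mx /passage_wt /= update_same pair_mx_ord2.
  rewrite (mulrA (word_mx y u1)) mxtrace_midZ /W word_wt_cat /T; ring.
rewrite sum_I (sum_chain o (fun p q => wt s p q * W * T (pair_mx (join_ends o p q)))).
(* Once the inner edge of the curl has a single colour, the crossing weight sums to that of an
   uncrossed strand. *)
transitivity (W * \sum_t kron R t.1 t.2 * T (pair_mx t)).
  rewrite big_distrr; apply: eq_bigr => t _ /=.
  under eq_bigr do rewrite segment_join -mulrA.
  rewrite -big_distrl mulrCA /=; congr (_ * _).
  by case: (o); [exact: cross_R1_over | exact: cross_R1_under].
by rewrite sum_pair_mx_tr /value word_mx_cat.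
Qed.

Lemma arrow_sum_R2 u1 u2 u3 a b s o :
  let w := u1 ++ [:: ov a s; ov b (~~ s)] ++ u2
     ++ ord2 o (un a s) (un b (~~ s)) ++ u3 in
  wf w -> arrow_sum w = arrow_sum (u1 ++ u2 ++ u3).
Proof.
move=> w wf_w.
have eL : perm_eq (labels w) ([:: a; a] ++ [:: b; b] ++ labels (u1 ++ u2 ++ u3)).
  by apply/seq.permP => p; rewrite /w !labels_cat !count_cat; case: (o) => /=; ring.
have := wf_fresh wf_w eL; rewrite perm_sym perm_catCA perm_sym in eL.
have := wf_fresh wf_w eL; rewrite !labels_cat !mem_cat !inE !negb_or.
case/and4P=> _ nb1 nb2 nb3 /and4P[/andP[nab _] na1 na2 na3].
have e : perm_eq (crossings w) (crossings (u1 ++ u2 ++ u3) ++ [:: a; b]).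
  apply/seq.permP => p; rewrite /w !crossings_cat !count_cat.
  by case: (o); rewrite /= /crossings /=; ring.
rewrite /arrow_sum (perm_sumout _ _ e) sumout_cat; apply: eq_sumout => y /=.
pose W := word_wt y (u1 ++ u2 ++ u3).
pose T (M M' : 'M[R]_n.+2) := \tr (word_mx y u1 * M * (word_mx y u2 * M' * word_mx y u3)).
pose F (i j : I) := wt s i.1 i.2 * wt (~~ s) j.1 j.2 * W *
  T (pair_mx (join_ends true i.1 j.1)) (pair_mx (join_ends o i.2 j.2)).
transitivity (\sum_i \sum_j ends_meet true i.1 j.1 * ends_meet o i.2 j.2 *
   F i j).
  apply: eq_bigr => i _; apply: eq_bigr => j _.
  have ya : update (update y a i) b j a = i by rewrite update_other // update_same.
  have yb : update (update y a i) b j b = j by rewrite update_same.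
  rewrite /value /w -[[:: _; _]]/(ord2 true _ _) !word_mx_cat !word_wt_cat.
  rewrite !word_mx_ord2 !word_wt_ord2.
  rewrite !(word_mx_update, word_wt_update) // /passage_mx /passage_wt /= ya yb.
  rewrite pair_mx_ord2 pair_mxM.
  rewrite -/(ends_meet true _ _) -/(join_ends true _ _).
  rewrite (mulrA (word_mx y u1)) mxtrace_midZ.
  rewrite (mulrA (_ * _) (word_mx y u2)) (mulrA (_ * word_mx y u2)) mxtrace_midZ.
  rewrite /F /W !word_wt_cat /T !(mulrA (_ * pair_mx _)); ring.
rewrite (sum_chain2 true o F).
transitivity (W * \sum_t kron R t.1 t.2 * \sum_u kron R u.1 u.2 * T (pair_mx t) (pair_mx u)).
  rewrite big_distrr; apply: eq_bigr => t _ /=.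
  rewrite !big_distrr; apply: eq_bigr => u _ /=.
  under eq_bigr do (under eq_bigr do rewrite /F !segment_join -mulrA; rewrite -big_distrl /=).
  rewrite -big_distrl /=.
  have -> : \sum_t1 \sum_u1 wt s (cut true t t1) (cut o u u1) *
      wt (~~ s) (cut false t t1) (cut (~~ o) u u1) = kron R t.1 t.2 * kron R u.1 u.2.
    by case: (o); [exact: cross_R2 | exact: cross_R2_rev].
  ring.
have eT M M' : T M M' = \tr (word_mx y u1 * M * word_mx y u2 * M' * word_mx y u3).
  by rewrite /T !mulrA.
under eq_bigr do (under eq_bigr do rewrite eT; rewrite sum_pair_mx_tr -mulrA).
by rewrite sum_pair_mx_tr /value !word_mx_cat.
Qed.

(* The strands of [o1], [o2], [o3] are the top, middle and bottom ones. *)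
Lemma sum_R3 s o1 o2 o3 (F : C * C -> C * C -> C * C -> R) :
  let s1 := s (+) o1 (+) o2 in
  let s2 := s (+) o1 (+) o3 in
  let s3 := s (+) o2 (+) o3 in
  let side o1 o2 o3 := \sum_i \sum_j \sum_k
    ends_meet o1 i.1 j.1 * ends_meet o2 i.2 k.1 * ends_meet o3 j.2 k.2 *
    (wt s1 i.1 i.2 * wt s2 j.1 j.2 * wt s3 k.1 k.2 *
     F (join_ends o1 i.1 j.1) (join_ends o2 i.2 k.1) (join_ends o3 j.2 k.2)) in
  side o1 o2 o3 = side (~~ o1) (~~ o2) (~~ o3).
Proof.
move=> s1 s2 s3.
have sideE p1 p2 p3 : \sum_i \sum_j \sum_k
    ends_meet p1 i.1 j.1 * ends_meet p2 i.2 k.1 * ends_meet p3 j.2 k.2 *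
    (wt s1 i.1 i.2 * wt s2 j.1 j.2 * wt s3 k.1 k.2 *
     F (join_ends p1 i.1 j.1) (join_ends p2 i.2 k.1) (join_ends p3 j.2 k.2)) =
  \sum_t \sum_m \sum_b
    cross_triangle A g s1 s2 s3 p1 p2 p3 t.1 t.2 m.1 m.2 b.1 b.2 * F t m b.
  rewrite (sum_chain3 p1 p2 p3 (fun i j k =>
    wt s1 i.1 i.2 * wt s2 j.1 j.2 * wt s3 k.1 k.2 *
    F (join_ends p1 i.1 j.1) (join_ends p2 i.2 k.1) (join_ends p3 j.2 k.2))).
  apply: eq_bigr => t _; apply: eq_bigr => m _; apply: eq_bigr => b _.
  rewrite /cross_triangle !big_distrl; apply: eq_bigr => t1 _ /=.
  rewrite !big_distrl; apply: eq_bigr => m1 _ /=.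
  by rewrite !big_distrl; apply: eq_bigr => b1 _ /=; rewrite !segment_join.
rewrite /= !sideE; apply: eq_bigr => t _; apply: eq_bigr => m _.
by apply: eq_bigr => b _; rewrite cross_R3.
Qed.

End Invariant.

From Stdlib Require Import Relations.Relation_Operators.



(** * Invariance under all moves *)

Section Invariance.

Variables (R : fieldType) (A : R) (n : nat).
Local Notation C := 'I_n.+2.
Hypothesis A_neq0 : A != 0.
Hypothesis A_loop : n.+2%:R = - A ^+ 2 - A ^- 2.
Variable g : C.
Local Notation wt := (cross_wt A g).
Local Notation I := ((C * C) * (C * C))%type.
Local Notation arrow_sum := (arrow_sum A g).

Section Triangle.

Variables (u1 u2 u3 u4 : seq passage) (x y z : nat) (s o1 o2 o3 : bool).
Let s1 := s (+) o1 (+) o2.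
Let s2 := s (+) o1 (+) o3.
Let s3 := s (+) o2 (+) o3.

(** The signs use the section variables [o1], [o2], [o3] and the orders use the arguments, because a
    third move reverses the orders but keeps the signs. *)
Definition tmb p1 p2 p3 :=
  u1 ++ ord2 p1 (ov x s1) (ov y s2) ++ u2 ++ ord2 p2 (un x s1) (ov z s3)
    ++ u3 ++ ord2 p3 (un y s2) (un z s3) ++ u4.

Definition tbm p1 p2 p3 :=
  u1 ++ ord2 p1 (ov x s1) (ov y s2) ++ u2 ++ ord2 p3 (un y s2) (un z s3)
    ++ u3 ++ ord2 p2 (un x s1) (ov z s3) ++ u4.

Lemma labels_tmb p1 p2 p3 : perm_eq (labels (tmb p1 p2 p3))
  ([:: x; x] ++ [:: y; y] ++ [:: z; z] ++ labels (u1 ++ u2 ++ u3 ++ u4)).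
Proof.
apply/seq.permP => a; rewrite /tmb !labels_cat !count_cat.
by case: p1 p2 p3 => [] [] [] /=; ring.
Qed.

Lemma labels_tbm p1 p2 p3 : perm_eq (labels (tbm p1 p2 p3))
  ([:: x; x] ++ [:: y; y] ++ [:: z; z] ++ labels (u1 ++ u2 ++ u3 ++ u4)).
Proof.
apply/seq.permP => a; rewrite /tbm !labels_cat !count_cat.
by case: p1 p2 p3 => [] [] [] /=; ring.
Qed.

Lemma fresh_triangle (w : seq passage) : wf w ->
  perm_eq (labels w) ([:: x; x] ++ [:: y; y] ++ [:: z; z] ++ labels (u1 ++ u2 ++ u3 ++ u4)) ->
  [/\ x != y, x != z & y != z] /\
  [/\ x \notin labels u1, x \notin labels u2, x \notin labels u3 & x \notin labels u4] /\
  [/\ y \notin labels u1, y \notin labels u2, y \notin labels u3 & y \notin labels u4] /\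
  [/\ z \notin labels u1, z \notin labels u2, z \notin labels u3 & z \notin labels u4].
Proof.
move=> wf_w e.
set L := labels (u1 ++ u2 ++ u3 ++ u4) in e *.
have ey : perm_eq (labels w) ([:: y; y] ++ [:: x; x] ++ [:: z; z] ++ L).
  by rewrite (permPl e) perm_catCA.
have ez : perm_eq (labels w) ([:: z; z] ++ [:: x; x] ++ [:: y; y] ++ L).
  by apply/seq.permP => a; rewrite (seq.permP e) !count_cat; ring.
have := wf_fresh wf_w e; have := wf_fresh wf_w ey; have := wf_fresh wf_w ez.
rewrite /L !labels_cat !mem_cat !inE !negb_or.
case/and3P=> _ _ /and4P[-> -> -> ->] /and3P[_ /andP[-> _] /and4P[-> -> -> ->]].
by case/and3P=> /andP[-> _] /andP[-> _] /and4P[-> -> -> ->].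
Qed.

Lemma crossings_tmb p1 p2 p3 : perm_eq (crossings (tmb p1 p2 p3))
  (crossings (u1 ++ u2 ++ u3 ++ u4) ++ [:: x; y; z]).
Proof.
apply/seq.permP => a; rewrite /tmb !crossings_cat !count_cat.
by case: p1 p2 p3 => [] [] []; rewrite /= /crossings /=; ring.
Qed.

Lemma crossings_tbm p1 p2 p3 : perm_eq (crossings (tbm p1 p2 p3))
  (crossings (u1 ++ u2 ++ u3 ++ u4) ++ [:: x; y; z]).
Proof.
apply/seq.permP => a; rewrite /tbm !crossings_cat !count_cat.
by case: p1 p2 p3 => [] [] []; rewrite /= /crossings /=; ring.
Qed.

Lemma mxtrace_mid3Z a b c (B1 B2 B3 B4 M1 M2 M3 : 'M[R]_n.+2) :
  \tr (B1 * (a *: M1 * (B2 * (b *: M2 * (B3 * (c *: M3 * B4)))))) =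
  a * b * c * \tr (B1 * M1 * B2 * M2 * B3 * M3 * B4).
Proof.
by rewrite -!mulmxE -!(scalemxAl, scalemxAr) !mxtraceZ !mulmxA !mulrA.
Qed.

(** The rest of the code enters only through a function [F] of the outer ends of the three strands,
    so the local identity [sum_R3] applies. *)
Lemma arrow_sum_tmb : wf (tmb o1 o2 o3) ->
  arrow_sum (tmb o1 o2 o3) = arrow_sum (tmb (~~ o1) (~~ o2) (~~ o3)).
Proof.
move=> wf_w; have := fresh_triangle wf_w (labels_tmb _ _ _).
case=> -[nxy nxz nyz] [[x1 x2 x3 x4] [[y1 y2 y3 y4] [z1 z2 z3 z4]]].
rewrite /arrow_sum !(perm_sumout _ _ (crossings_tmb _ _ _)) !sumout_cat.
apply: eq_sumout => v.
pose B u := word_mx R v u.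
pose F p q r := word_wt A g v (u1 ++ u2 ++ u3 ++ u4) *
  \tr (B u1 * pair_mx R p * B u2 * pair_mx R q * B u3 * pair_mx R r * B u4).
have E p1 p2 p3 : sumout [:: x; y; z] ((value A g)^~ (tmb p1 p2 p3)) v =
  \sum_i \sum_j \sum_k
    ends_meet R p1 i.1 j.1 * ends_meet R p2 i.2 k.1 * ends_meet R p3 j.2 k.2 *
    (wt s1 i.1 i.2 * wt s2 j.1 j.2 * wt s3 k.1 k.2 *
     F (join_ends p1 i.1 j.1) (join_ends p2 i.2 k.1) (join_ends p3 j.2 k.2)).
  apply: eq_bigr => i _; apply: eq_bigr => j _; apply: eq_bigr => k _.
  pose vv := update (update (update v x i) y j) z k.
  rewrite -[LHS]/(value A g vv (tmb p1 p2 p3)).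
  have vx : vv x = i.
    apply: etrans (update_other _ _ nxz) _.
    exact: etrans (update_other _ _ nxy) (update_same _ _ _).
  have vy : vv y = j by exact: etrans (update_other _ _ nyz) (update_same _ _ _).
  have vz : vv z = k by rewrite /vv update_same.
  have eB u : [/\ x \notin labels u, y \notin labels u & z \notin labels u] ->
      word_mx R vv u = B u /\ word_wt A g vv u = word_wt A g v u.
    by case=> *; rewrite /vv !word_mx_update ?word_wt_update.
  have [a1 b1] := eB u1 (And3 x1 y1 z1); have [a2 b2] := eB u2 (And3 x2 y2 z2).
  have [a3 b3] := eB u3 (And3 x3 y3 z3); have [a4 b4] := eB u4 (And3 x4 y4 z4).
  rewrite /value /tmb !word_mx_cat !word_wt_cat !word_mx_ord2 !word_wt_ord2.
  rewrite a1 a2 a3 a4 b1 b2 b3 b4 /passage_mx /passage_wt /= vx vy vz !pair_mx_ord2.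
  rewrite mxtrace_mid3Z /F !word_wt_cat; ring.
rewrite !E.
exact: (sum_R3 A_neq0 A_loop g s o1 o2 o3 F).
Qed.

Lemma arrow_sum_tbm : wf (tbm o1 o2 o3) ->
  arrow_sum (tbm o1 o2 o3) = arrow_sum (tbm (~~ o1) (~~ o2) (~~ o3)).
Proof.
move=> wf_w; have := fresh_triangle wf_w (labels_tbm _ _ _).
case=> -[nxy nxz nyz] [[x1 x2 x3 x4] [[y1 y2 y3 y4] [z1 z2 z3 z4]]].
rewrite /arrow_sum !(perm_sumout _ _ (crossings_tbm _ _ _)) !sumout_cat.
apply: eq_sumout => v.
pose B u := word_mx R v u.
(* Here the bottom strand comes before the middle one along the knot, so the slots of [q] and [r]
   are exchanged. *)
pose F p q r := word_wt A g v (u1 ++ u2 ++ u3 ++ u4) *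
  \tr (B u1 * pair_mx R p * B u2 * pair_mx R r * B u3 * pair_mx R q * B u4).
have E p1 p2 p3 : sumout [:: x; y; z] ((value A g)^~ (tbm p1 p2 p3)) v =
  \sum_i \sum_j \sum_k
    ends_meet R p1 i.1 j.1 * ends_meet R p2 i.2 k.1 * ends_meet R p3 j.2 k.2 *
    (wt s1 i.1 i.2 * wt s2 j.1 j.2 * wt s3 k.1 k.2 *
     F (join_ends p1 i.1 j.1) (join_ends p2 i.2 k.1) (join_ends p3 j.2 k.2)).
  apply: eq_bigr => i _; apply: eq_bigr => j _; apply: eq_bigr => k _.
  pose vv := update (update (update v x i) y j) z k.
  rewrite -[LHS]/(value A g vv (tbm p1 p2 p3)).
  have vx : vv x = i.
    apply: etrans (update_other _ _ nxz) _.
    exact: etrans (update_other _ _ nxy) (update_same _ _ _).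
  have vy : vv y = j by exact: etrans (update_other _ _ nyz) (update_same _ _ _).
  have vz : vv z = k by rewrite /vv update_same.
  have eB u : [/\ x \notin labels u, y \notin labels u & z \notin labels u] ->
      word_mx R vv u = B u /\ word_wt A g vv u = word_wt A g v u.
    by case=> *; rewrite /vv !word_mx_update ?word_wt_update.
  have [a1 b1] := eB u1 (And3 x1 y1 z1); have [a2 b2] := eB u2 (And3 x2 y2 z2).
  have [a3 b3] := eB u3 (And3 x3 y3 z3); have [a4 b4] := eB u4 (And3 x4 y4 z4).
  rewrite /value /tbm !word_mx_cat !word_wt_cat !word_mx_ord2 !word_wt_ord2.
  rewrite a1 a2 a3 a4 b1 b2 b3 b4 /passage_mx /passage_wt /= vx vy vz !pair_mx_ord2.
  rewrite mxtrace_mid3Z /F !word_wt_cat; ring.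
rewrite !E.
exact: (sum_R3 A_neq0 A_loop g s o1 o2 o3 F).
Qed.


End Triangle.
(** The witness is the common orientation of the triangle, from which each sign is recovered by a
    second exclusive or. *)
Lemma triangle_sign (sx sy sz o1 o2 o3 : bool) :
  sx (+) o1 (+) o2 = sy (+) o1 (+) o3 -> sx (+) o1 (+) o2 = sz (+) o2 (+) o3 ->
  exists s, [/\ sx = s (+) o1 (+) o2, sy = s (+) o1 (+) o3 & sz = s (+) o2 (+) o3].
Proof.
by move=> e1 e2; exists (sx (+) o1 (+) o2); move: e1 e2;
  case: o1 o2 o3 sx sy sz => [] [] [] [] [] [].
Qed.

Lemma arrow_sum_reidemeister w w' : wf w -> reidemeister w w' ->
  arrow_sum w = arrow_sum w'.
Proof.
move=> wf_w r; case: r wf_w => {w w'}.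
- by move=> u1 u2 c s o; exact: arrow_sum_R1.
- by move=> u1 u2 u3 a b s o; exact: arrow_sum_R2.
- move=> u1 u2 u3 u4 x y z sx sy sz o1 o2 o3 e1 e2.
  by have [s [-> -> ->]] := triangle_sign e1 e2; exact: arrow_sum_tmb.
- move=> u1 u2 u3 u4 x y z sx sy sz o1 o2 o3 e1 e2.
  by have [s [-> -> ->]] := triangle_sign e1 e2; exact: arrow_sum_tbm.
Qed.

Lemma eq_filter_all (T : Type) (a1 a2 : pred T) v :
  all (fun p => a1 p == a2 p) v -> [seq p <- v | a1 p] = [seq p <- v | a2 p].
Proof. by elim: v => //= p v IH /andP[/eqP-> /IH->]. Qed.

(** A label occurs twice and [facing] pairs virtual passages with virtual ones, so no label of a
    virtual arc can occur at a classical passage. *)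
Lemma wf_arc b v p : wf (b ++ v) -> all is_virtual b -> label p \in labels b ->
  ~~ has (fun q => ~~ is_virtual q && (label q == label p)) v.
Proof.
move=> wf_w virt_b p_b; apply/negP => has_v.
have p_in : label p \in labels (b ++ v) by rewrite labels_cat mem_cat p_b.
have [q [r [+ _ +]]] := wfP wf_w p_in; rewrite filter_cat.
have : all is_virtual [seq q <- b | label q == label p].
  by rewrite all_filter; apply: sub_all virt_b => q' /= ->; rewrite implybT.
have : has (fun q => ~~ is_virtual q) [seq q <- v | label q == label p].
  by rewrite has_count count_filter -has_count.
have : (0 < size [seq q <- b | label q == label p])%N.
  by rewrite size_filter -has_count -(has_map label (pred1 (label p))) has_pred1.
case: [seq q <- b | _] => // q1 [|q2 s1] _.
  case: [seq q <- v | _] => [|r1 [|r2 s2]] //= + + [<- <-].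
  by rewrite /is_virtual orbF andbT; case: (kind q1) (kind r1) => [] [].
by case: [seq q <- v | _] s1 => [|r1 s2] [].
Qed.

Lemma real_arc b v : wf (b ++ v) -> all is_virtual b ->
  [seq p <- b ++ v | ~~ is_virtual p] = [seq p <- erase_arc b v | ~~ is_virtual p].
Proof.
move=> wf_w virt_b; rewrite filter_cat (eq_filter_all (a2 := pred0)); last first.
  by apply: sub_all virt_b => p ->.
rewrite filter_pred0 /= /erase_arc -filter_predI; apply: eq_filter_all.
pose p0 := Passage 0 Over true; apply/(all_nthP p0) => i lt_i.
rewrite /=; case: (boolP (label (nth p0 v i) \in labels b)) => p_b; last by rewrite andbT.
rewrite andbF; apply/eqP; apply: contraNF (wf_arc wf_w virt_b p_b) => r_p.
by apply/(has_nthP p0); exists i; rewrite // r_p eqxx.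
Qed.

(** Erasing a virtual arc removes only virtual passages, so a detour leaves the sequence of
    classical passages unchanged. *)
Lemma arrow_sum_detour w w' : wf w -> wf w' -> detour w w' -> arrow_sum w = arrow_sum w'.
Proof.
move=> wf_w wf_w' d; case: d wf_w wf_w' => a u a' u' va va' e wf_w wf_w'.
rewrite -(arrow_sum_filter _ _ (a ++ u)) -(arrow_sum_filter _ _ (a' ++ u')).
by rewrite !real_arc // e.
Qed.

Lemma virtual_equiv_arrow_sum w w' : virtual_equiv w w' -> arrow_sum w = arrow_sum w'.
Proof.
elim=> {w w'} [w w' [/andP[wf_w _] /andP[wf_w' _]]|||] //; last first.
  by move=> u v w _ -> _ ->.
case=> [iso | | ]; [|exact: arrow_sum_reidemeister|exact: arrow_sum_detour].
by case: iso => [n0 u|f u inj_f]; rewrite ?arrow_sum_rot ?arrow_sum_relabel.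
Qed.

Lemma classical_equiv_arrow_sum w w' : classical_equiv w w' -> arrow_sum w = arrow_sum w'.
Proof.
move=> e; apply: virtual_equiv_arrow_sum.
elim: e => {w w'} [w w' [/andP[dw _] /andP[dw' _] r]|w|w w' _|u v w _ ? _]; last 3 first.
- exact: rst_refl.
- exact: rst_sym.
- exact: rst_trans.
by apply: rst_step; split=> //; case: r => r; [constructor 1|constructor 2].
Qed.

End Invariance.

(** * Alexander numberings of planar diagrams *)

Lemma map_at_pos w : [seq at_pos i | i <- enum 'I_(size w)] = w.
Proof. exact: (map_tnth_enum (in_tuple w)). Qed.

Lemma partner_spec w (i : 'I_(size w)) : wf w ->
  [/\ partner i != i, label (at_pos (partner i)) = label (at_pos i),
      dir (at_pos (partner i)) = ~~ dir (at_pos i),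
      facing (kind (at_pos i)) (kind (at_pos (partner i)))
    & forall j, label (at_pos j) = label (at_pos i) -> j = i \/ j = partner i].
Proof.
move=> wf_w; set c := label (at_pos i).
have c_in : c \in labels w.
  by rewrite -[w in labels w]map_at_pos /labels -map_comp; apply/map_f; rewrite mem_enum.
have [q [r [e d f]]] := wfP wf_w c_in.
have [s es mem_s] : exists2 s : seq 'I_(size w), [seq at_pos j | j <- s] = [:: q; r] &
    uniq s /\ forall j, (j \in s) = (label (at_pos j) == c).
  exists [seq j <- enum 'I_(size w) | label (at_pos j) == c].
    by rewrite -e -[in RHS](map_at_pos w) filter_map.
  split=> [|j]; first by rewrite filter_uniq // enum_uniq.
  by rewrite mem_filter mem_enum andbT.
case: s es mem_s => [|j1 [|j2 []]] //= [eq er] [/andP[+ _] mem_s].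
rewrite inE => nj; have := mem_s i; rewrite eqxx !inE => ij.
pose k := if i == j1 then j2 else j1.
have kP j : ((j != i) && (label (at_pos j) == c)) = (j == k).
  rewrite -mem_s !inE /k; case/orP: ij => /eqP->.
    by rewrite eqxx; case: (eqVneq j j1) => [->|]; rewrite //= (negbTE nj).
  rewrite (eq_sym j2 j1) (negbTE nj).
  by case: (eqVneq j j2) => [->|]; rewrite /= ?orbF // eq_sym (negbTE nj).
have -> : partner i = k.
  rewrite /partner; case: pickP => [j|/(_ k)]; rewrite /= -/c kP ?eqxx //.
  by move/eqP.
have /andP[nki /eqP lk] : (k != i) && (label (at_pos k) == c) by rewrite kP.
split=> // [||j /eqP lj]; last first.
  by have := kP j; rewrite lj andbT; case: eqVneq => [->|_ /esym/eqP ->]; [left|right].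
all: rewrite /k; case/orP: ij => /eqP->; rewrite ?eqxx ?(eq_sym j2 j1) ?(negbTE nj) ?eq ?er.
- by move: f; case: (kind q) (kind r) => [] [].
- by move: f; case: (kind q) (kind r) => [] [].
- by move: d; case: (dir q) (dir r) => [] [].
- by move: d; case: (dir q) (dir r) => [] [].
Qed.

Lemma partnerK w : wf w -> involutive (@partner w).
Proof.
move=> wf_w i; have [n1 l1 _ _ _] := partner_spec i wf_w.
have [n2 l2 _ _ /(_ i (esym l1))] := partner_spec (partner i) wf_w.
by case=> // ei; rewrite -ei eqxx in n1.
Qed.

Lemma dir_partner w (i : 'I_(size w)) : wf w ->
  dir (at_pos (partner i)) = ~~ dir (at_pos i).
Proof. by move=> wf_w; case: (partner_spec i wf_w). Qed.

Lemma classical_at w (i : 'I_(size w)) : ~~ has is_virtual w -> ~~ is_virtual (at_pos i).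
Proof.
move=> cl; apply: contra cl => v; apply/(has_nthP (at_pos i)); exists i => //.
by rewrite -(tnth_nth _ (in_tuple w)).
Qed.

Lemma over_partner w (i : 'I_(size w)) : wf w -> ~~ has is_virtual w ->
  is_over (at_pos (partner i)) = ~~ is_over (at_pos i).
Proof.
move=> wf_w cl; have [_ _ _ + _] := partner_spec i wf_w.
have := classical_at i cl; rewrite /is_virtual /is_over.
by case: (kind (at_pos i)) (kind (at_pos (partner i))) => [] [].
Qed.

Lemma edgeK w : involutive (@edge w).
Proof. by case=> i [] /=; rewrite /edge /= ?ordSK ?ord_predK. Qed.

Lemma turn2 w (x : dart w) : wf w -> turn (turn x) = (x.1, ~~ x.2).
Proof.
case: x => i b wf_w; rewrite /turn /= partnerK // dir_partner //.
by case: (dir _) b => [] [].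
Qed.

Lemma turn_inj w : wf w -> injective (@turn w).
Proof.
move=> wf_w x y /(congr1 (@turn w)); rewrite !turn2 //.
by case: x y => [i b] [j c] [-> /negb_inj->].
Qed.

Lemma card_overs w : wf w -> ~~ has is_virtual w -> (size w = #|overs w|.*2)%N.
Proof.
move=> wf_w cl; rewrite -[LHS]card_ord -(cardsC (overs w)) -addnn; congr addn.
rewrite -(card_imset _ (can_inj (partnerK wf_w))); congr #|pred_of_set _|.
apply/setP => i; rewrite !inE; apply/imsetP/idP => [[j o ->]|u].
  by move: o; rewrite over_partner // !inE.
by exists (partner i); rewrite ?partnerK // !inE over_partner // u.
Qed.

Lemma sum_mul_eq (F : pzSemiRingType) (T : finType) (a : T) (f : T -> F) :
  \sum_r f r * (a == r)%:R = f a.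
Proof.
rewrite (bigD1 a) //= eqxx mulr1 big1 ?addr0 // => r /negbTE n_r.
by rewrite eq_sym n_r mulr0.
Qed.

Section Numbering.

Variables (F : fieldType) (w : seq passage).
Hypothesis w_diagram : classical_diagram w.
Hypothesis w_neq0 : (0 < size w)%N.
Local Notation pos := 'I_(size w).
Local Notation next := (@ordS (size w)).

Let wf_w : wf w. Proof. by case/andP: w_diagram => /andP[]. Qed.
Let cl_w : ~~ has is_virtual w. Proof. by case/andP: w_diagram. Qed.

Definition step (x : dart w) : dart w := turn (edge x).

Lemma step_sym : connect_sym (frel step).
Proof. exact/fconnect_sym/inj_comp/inv_inj/edgeK/turn_inj. Qed.

Definition face_root (x : dart w) : bool := froots step x.

(** This is Euler's formula, each crossing being counted by its over-passage. *)
Lemma card_face_root : #|face_root| = (#|overs w| + 2)%N.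
Proof.
have /andP[/andP[_]] := w_diagram; rewrite /planar /nilp eqn0Ngt w_neq0.
rewrite /= => /eqP e _; move: e; rewrite {1}card_overs // doubleK => <-.
by apply: eq_card => x; rewrite !inE andbT.
Qed.

Definition face_index (x : dart w) : 'I_#|face_root| :=
  enum_rank_in (roots_root step_sym x : froot step x \in face_root) (froot step x).

Lemma enum_face_index x : enum_val (face_index x) = froot step x.
Proof. by rewrite enum_rankK_in //; exact: roots_root step_sym x. Qed.

Lemma face_index_step x : face_index (step x) = face_index x.
Proof.
apply: enum_val_inj; rewrite !enum_face_index; symmetry.
exact/(fingraph.rootP step_sym)/fconnect1.
Qed.

Lemma face_index_turn x : face_index (turn x) = face_index (edge x).
Proof. by rewrite -[in LHS](edgeK x) -/(step _) face_index_step. Qed.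

Lemma face_index_onto r : exists x, r = face_index x.
Proof.
exists (enum_val r); apply: enum_val_inj; rewrite enum_face_index.
by have /eqP := enum_valP r.
Qed.

Lemma over_pos_in i : over_pos i \in overs w.
Proof.
rewrite inE /over_pos; case: ifP => // /negbT o.
by rewrite over_partner.
Qed.

Definition crossing_index (i : pos) : 'I_#|overs w| :=
  enum_rank_in (over_pos_in i) (over_pos i).

Lemma enum_crossing_index i : enum_val (crossing_index i) = over_pos i.
Proof. by rewrite enum_rankK_in //; exact: over_pos_in. Qed.

Lemma crossing_index_onto c : exists i, c = crossing_index i.
Proof.
exists (enum_val c); apply: enum_val_inj; rewrite enum_crossing_index /over_pos.
by have := enum_valP c; rewrite inE => ->.
Qed.

Lemma crossing_index_partner i : crossing_index (partner i) = crossing_index i.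
Proof.
apply: enum_val_inj; rewrite !enum_crossing_index /over_pos over_partner //.
by case: (is_over (at_pos i)); rewrite /= ?partnerK.
Qed.

Lemma crossing_index_eq i j :
  (crossing_index j == crossing_index i) = (j == i) || (j == partner i).
Proof.
apply/eqP/orP => [|[/eqP->|/eqP->]]; rewrite ?crossing_index_partner //.
move/(congr1 enum_val); rewrite !enum_crossing_index /over_pos.
case: ifP => _; case: ifP => _ e.
- by left; apply/eqP.
- by right; apply/eqP.
- by right; rewrite -e partnerK.
- by left; apply/eqP/(inv_inj (partnerK wf_w)).
Qed.

(** A knot has one component: [next] is a single cycle through all positions. *)
Lemma pos_ind (P : pos -> Prop) :
  (forall i, P i -> P (next i)) -> forall i j, P i -> P j.
Proof.
move=> Pnext i j Pi.
have Pk k : P (iter k next i) by elim: k => //= k; exact: Pnext.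
have Ek k : nat_of_ord (iter k next i) = ((i + k) %% size w)%N.
  elim: k => [|k IH]; first by rewrite addn0 modn_small.
  by rewrite /= IH -addn1 modnDml addn1 addnS.
suff -> : j = iter (size w - i + j) next i by [].
apply: val_inj; rewrite [RHS]Ek addnA subnKC ?modnDl ?modn_small //.
exact: ltnW.
Qed.

(** The cellular boundary from faces to edges, followed below by the one from edges to crossings.
    The index [e] stands for the edge leaving position [e]. *)
Definition face_edge : 'M[F]_(#|face_root|, size w) :=
  \matrix_(r, e) ((face_index (e, true) == r)%:R
    - (face_index (edge (e, true)) == r)%:R).

Definition edge_crossing : 'M[F]_(size w, #|overs w|) :=
  \matrix_(e, c) ((crossing_index (next e) == c)%:R - (crossing_index e == c)%:R).

Lemma mul_face_edge (h : 'rV[F]_#|face_root|) e :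
  (h *m face_edge) 0 e =
  h 0 (face_index (e, true)) - h 0 (face_index (edge (e, true))).
Proof.
by rewrite mxE; under eq_bigr do rewrite mxE mulrBr; rewrite sumrB !sum_mul_eq.
Qed.

Lemma mul_edge_crossing (p : 'cV[F]_#|overs w|) e :
  (edge_crossing *m p) e 0 = p (crossing_index (next e)) 0 - p (crossing_index e) 0.
Proof.
rewrite mxE; under eq_bigr do rewrite mxE mulrC mulrBr.
by rewrite sumrB !sum_mul_eq.
Qed.

(* The only cellular 2-cycles are the constant ones, since the surface is connected. *)
Lemma rank_face_edge : (#|overs w| < \rank face_edge)%N.
Proof.
suff : (\rank (kermx face_edge) <= 1)%N by rewrite mxrank_ker; have := card_face_root; lia.
suff : (kermx face_edge <= (const_mx 1 : 'rV[F]_#|face_root|))%MS.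
  by move/mxrankS/leq_trans; apply; exact: rank_leq_row.
apply/row_subP => k; set h := row k _.
have h0 : h *m face_edge = 0 by apply/sub_kermxP/row_sub.
have h_edge x : h 0 (face_index (edge x)) = h 0 (face_index x).
  have E e : h 0 (face_index (e, true)) = h 0 (face_index (edge (e, true))).
    by apply/eqP; rewrite -subr_eq0 -mul_face_edge h0 mxE.
  by case: x => i [] //; rewrite -[in RHS](edgeK (i, false)) -E.
have h_turn x : h 0 (face_index (turn x)) = h 0 (face_index x).
  by rewrite face_index_turn.
have h_flip i b c : h 0 (face_index (i, b)) = h 0 (face_index (i, c)).
  have E d : h 0 (face_index (i, ~~ d)) = h 0 (face_index (i, d)).
    by rewrite -[(i, ~~ d)](turn2 (i, d)) // !h_turn.
  by case: b c => [] [] //; rewrite -?(E true) -?(E false).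
pose i0 := Ordinal w_neq0.
have h_const x : h 0 (face_index x) = h 0 (face_index (i0, true)).
  case: x => i b; rewrite (h_flip i b true).
  apply: (pos_ind (P := fun i => h 0 (face_index (i, true)) =
    h 0 (face_index (i0, true))) _ (i := i0)) => // j <-.
  by rewrite (h_flip _ true false) -[(next j, false)]/(edge (j, true)) h_edge.
have -> : h = h 0 (face_index (i0, true)) *: const_mx 1.
  apply/rowP => r; have [x ->] := face_index_onto r.
  by rewrite h_const !mxE mulr1.
exact: scalemx_sub.
Qed.

(** A function on the crossings with zero coboundary is constant along the knot, which passes
    through every crossing. *)
Lemma rank_edge_crossing : (#|overs w| <= \rank edge_crossing + 1)%N.
Proof.
suff : (\rank (kermx edge_crossing^T) <= 1)%N by rewrite mxrank_ker mxrank_tr; lia.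
suff : (kermx edge_crossing^T <= (const_mx 1 : 'rV[F]_#|overs w|))%MS.
  by move/mxrankS/leq_trans; apply; exact: rank_leq_row.
apply/row_subP => k; set p := row k _.
have p0 : p *m edge_crossing^T = 0 by apply/sub_kermxP/row_sub.
have p_next i : p 0 (crossing_index (next i)) = p 0 (crossing_index i).
  apply/eqP; rewrite -subr_eq0; have := mul_edge_crossing p^T i.
  by rewrite -[edge_crossing]trmxK -trmx_mul p0 !mxE => <-.
pose i0 := Ordinal w_neq0.
have p_const i : p 0 (crossing_index i) = p 0 (crossing_index i0).
  by apply: (pos_ind (P := fun i => p 0 (crossing_index i) =
    p 0 (crossing_index i0)) _ (i := i0)) => // j <-.
have -> : p = p 0 (crossing_index i0) *: const_mx 1.
  apply/rowP => c; have [i ->] := crossing_index_onto c.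
  by rewrite p_const !mxE mulr1.
exact: scalemx_sub.
Qed.

Lemma mul_face_crossing : face_edge *m edge_crossing = 0.
Proof.
apply/row_matrixP => r; rewrite row_mul rowE -mulmxA row0.
set h := delta_mx _ _; pose u e := (h *m face_edge) 0 e.
apply/rowP => c; have [i ->] := crossing_index_onto c.
rewrite mulmxA mxE [RHS]mxE; under eq_bigr do rewrite [edge_crossing _ _]mxE mulrBr.
rewrite sumrB (reindex_inj (can_inj (@ord_predK _))) /=.
under eq_bigr do rewrite ord_predK.
have sumD (f : pos -> F) : \sum_j f j * (crossing_index j == crossing_index i)%:R =
    f i + f (partner i).
  rewrite -(sum_mul_eq i f) -(sum_mul_eq (partner i) f) -big_split /=.
  apply: eq_bigr => j _; rewrite crossing_index_eq -mulrDr !(eq_sym _ j).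
  congr (_ * _); have [ni _ _ _ _] := partner_spec i wf_w.
  by case: (eqVneq j i) => [->|_]; rewrite ?add0r // eq_sym (negbTE ni) addr0.
rewrite !sumD -!/(u _).
pose H x := h 0 (face_index x); pose S j := H (j, true) + H (j, false).
have uE e : u e = H (e, true) - H (turn (e, true)) by rewrite /u mul_face_edge -face_index_turn.
have uP e : u (ord_pred e) = H (turn (e, false)) - H (e, false).
  rewrite /u mul_face_edge /H face_index_turn /edge /=.
  by rewrite ord_predK.
(* The jump of [u] at one passage is a difference of sums of [H] over the darts of the two
   positions; the jumps at the two passages of a crossing cancel. *)
have D e : u (ord_pred e) - u e = S (partner e) - S e.
  by rewrite uP uE /S /turn /=; case: (dir _); rewrite /=; ring.
transitivity ((u (ord_pred i) - u i) + (u (ord_pred (partner i)) - u (partner i))); first ring.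
by rewrite !D partnerK //; ring.
Qed.

(* Euler's formula makes the rank bounds sharp, so that every edge chain without boundary, such
   as the knot itself, bounds a combination [h] of faces. *)
Lemma numbering_aux : exists nu : pos -> F, forall i, dir (at_pos i) ->
  [/\ nu (partner i) = nu i + 1, nu (next i) = nu i + 1 & nu (next (partner i)) = nu i].
Proof.
have sub : (face_edge <= kermx edge_crossing)%MS by apply/sub_kermxP/mul_face_crossing.
have : (const_mx 1 : 'rV_(size w)) *m edge_crossing = 0.
  apply/rowP => c; rewrite mxE [RHS]mxE; under eq_bigr do rewrite !mxE mulrBr.
  rewrite sumrB (reindex_inj (can_inj (@ord_predK _))) /=.
  by under eq_bigr do rewrite ord_predK; rewrite subrr.
move/sub_kermxP => /submx_trans sub1.
have /submxP[h eh] : ((const_mx 1 : 'rV_(size w)) <= face_edge)%MS.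
  (* There are twice as many edges as crossings, so the cycles have dimension at most
     [#|overs w| + 1]. The boundaries have at least this dimension, hence are all the cycles. *)
  apply: sub1; rewrite -(geq_leqif (mxrank_leqif_sup sub)) mxrank_ker.
  have := rank_face_edge; have := rank_edge_crossing.
  by have := card_overs wf_w cl_w; lia.
pose H x := h 0 (face_index x).
have uE e : H (e, true) - H (turn (e, true)) = 1.
  by rewrite /H face_index_turn -mul_face_edge -eh mxE.
have uP e : H (turn (e, false)) - H (e, false) = 1.
  rewrite /H face_index_turn -[X in _ - h 0 (face_index X)]edgeK.
  by rewrite /edge /= -mul_face_edge -eh mxE.
(* The number of the edge entering position [i] is the coefficient in [h] of the face of the dart
   [(i, false)]. *)
exists (fun i => H (i, false)) => i di; set j := partner i.
have nextE e : H (next e, false) = H (turn (e, true)) by rewrite /H face_index_turn.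
have := uE i; have := uP i; have := uP j; rewrite !nextE.
rewrite /turn /= di dir_partner // di partnerK //= -/j.
move=> /eqP + /eqP + /eqP; rewrite !subr_eq => /eqP e1 /eqP e2 /eqP e3.
split=> //; first by rewrite e2 addrC.
by apply: (addrI 1); rewrite -e3 e1 e2; ring.
Qed.

End Numbering.

Lemma numbering (F : fieldType) w : classical_diagram w ->
  exists nu : 'I_(size w) -> F, forall i, dir (at_pos i) ->
  [/\ nu (partner i) = nu i + 1, nu (ordS i) = nu i + 1 & nu (ordS (partner i)) = nu i].
Proof.
move=> d; case: (posnP (size w)) => [w0|]; last exact: numbering_aux.
by exists (fun=> 0) => i; have := ltn_ord i; rewrite {2}w0.
Qed.

(** * Colourings of edges *)

Section SumoutTheory.

Variables (R : comPzRingType) (I : finType).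
Implicit Types (cs : seq nat) (y : nat -> I).

Lemma sumout_sum (T : finType) cs (F : T -> (nat -> I) -> R) y :
  sumout cs (fun y => \sum_t F t y) y = \sum_t sumout cs (F t) y.
Proof.
elim: cs y => //= c cs IH y; rewrite exchange_big /=.
by apply: eq_bigr => i _; rewrite IH.
Qed.

Lemma sumout_mull cs c (h : I -> R) (F : (nat -> I) -> R) y : c \notin cs ->
  sumout cs (fun y => h (y c) * F y) y = h (y c) * sumout cs F y.
Proof.
elim: cs y => //= d cs IH y; rewrite inE negb_or => /andP[ncd nc].
by rewrite big_distrr; apply: eq_bigr => i _ /=; rewrite IH // update_other.
Qed.

Lemma sumout_prod (T : eqType) (s : seq T) (k : T -> nat) (h : T -> I -> R) y :
  uniq [seq k x | x <- s] ->
  sumout [seq k x | x <- s] (fun y => \prod_(x <- s) h x (y (k x))) y =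
  \prod_(x <- s) \sum_i h x i.
Proof.
elim: s y => [|x s IH] y /=; first by rewrite !big_nil.
case/andP=> nk u; rewrite big_cons big_distrl; apply: eq_bigr => i _ /=.
rewrite -(IH (update y (k x) i) u) -[X in h x X](update_same y (k x) i) -(sumout_mull (h x)) //.
by apply: eq_sumout => z; rewrite big_cons.
Qed.

End SumoutTheory.

(** * Traces of matrix products as sums over closed paths *)

Section TraceExpansion.

Variables (R : comPzRingType) (n : nat).
Local Notation C := 'I_n.+1.

Fixpoint path_weight (Ms : seq 'M[R]_n.+1) (cs : seq C) (b : C) : R :=
  match Ms, cs with
  | M :: Ms', c :: cs' => M c (head b cs') * path_weight Ms' cs' b
  | _, _ => 1
  end.

Lemma sum_tuple_cons m (F : m.+1.-tuple C -> R) :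
  \sum_t F t = \sum_c \sum_(t : m.-tuple C) F (cons_tuple c t).
Proof.
rewrite pair_bigA /= (reindex (fun p => cons_tuple p.1 p.2)) //=.
exists (fun t => (thead t, behead_tuple t)) => [[c t] _|t _] /=.
  by congr pair; apply: val_inj.
by case/tupleP: t => c t; apply: val_inj.
Qed.

Fixpoint mprod (Ms : seq 'M[R]_n.+1) : 'M[R]_n.+1 :=
  if Ms is M :: Ms' then M *m mprod Ms' else 1%:M.

Lemma mprodE (T : Type) (s : seq T) (M : T -> 'M[R]_n.+1) :
  \prod_(x <- s) M x = mprod [seq M x | x <- s].
Proof. by elim: s => [|x s IH]; rewrite ?big_nil ?big_cons ?IH. Qed.

Lemma mprod_entry (Ms : seq 'M[R]_n.+1) a b :
  mprod Ms a b =
  \sum_(t : (size Ms).-tuple C) (head b t == a)%:R * path_weight Ms t b.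
Proof.
elim: Ms a => [|M Ms IH] a.
  rewrite (bigD1 [tuple]) //= big1 => [|t /eqP[]]; last exact: tuple0.
  by rewrite mulr1 addr0 mxE eq_sym.
rewrite mxE; under eq_bigr do rewrite IH.
rewrite sum_tuple_cons /= [RHS](bigD1 a) //= [X in _ = _ + X]big1 => [|c /negbTE nc].
  rewrite addr0; under eq_bigr do rewrite big_distrr /=.
  rewrite exchange_big; apply: eq_bigr => t _ /=; rewrite eqxx mul1r.
  rewrite (bigD1 (head b t)) //= eqxx mul1r big1 ?addr0 // => c /negbTE nc.
  by rewrite eq_sym nc mul0r mulr0.
by rewrite big1 // => t _; rewrite nc mul0r.
Qed.

Lemma path_weightE (M0 : 'M[R]_n.+1) Ms cs b : size cs = size Ms ->
  path_weight Ms cs b =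
  \prod_(i < size Ms) nth M0 Ms i (nth b cs i) (nth b cs i.+1).
Proof.
elim: Ms cs => [|M Ms IH] [|c cs] //= => [_|[sz]]; first by rewrite big_ord0.
by rewrite big_ord_recl /= nth0 IH.
Qed.

Lemma mxtrace_prod m (M : 'I_m -> 'M[R]_n.+1) : (0 < m)%N ->
  \tr (mprod [seq M i | i <- enum 'I_m]) =
  \sum_(f : {ffun 'I_m -> C}) \prod_i M i (f i) (f (ordS i)).
Proof.
move=> m0; pose Ms := [seq M i | i <- enum 'I_m].
have sz : size Ms = m by rewrite size_map size_enum_ord.
rewrite -/Ms /mxtrace.
under eq_bigr do rewrite mprod_entry.
rewrite exchange_big /=.
have head_head (s : seq C) : head (head 0 s) s = head 0 s by case: s.
transitivity (\sum_(t : (size Ms).-tuple C) path_weight Ms t (head 0 t)).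
  apply: eq_bigr => t _; rewrite (bigD1 (head 0 t)) //= big1 ?addr0.
    by rewrite head_head eqxx mul1r.
  move=> i ni; have -> : head i t = head 0 t.
    have : size (tval t) = m by rewrite size_tuple.
    by case: (tval t) => //= e; rewrite -e in m0.
  by rewrite eq_sym (negbTE ni) mul0r.
have sum_size k (F : seq C -> R) : size Ms = k ->
  \sum_(t : (size Ms).-tuple C) F t = \sum_(t : k.-tuple C) F t by move=> <-.
rewrite (sum_size m (fun t => path_weight Ms t (head 0 t)) sz).
rewrite (reindex (fun f : {ffun 'I_m -> C} => [tuple f i | i < m])); last first.
  exists (fun t => [ffun i => tnth t i]) => [f _|t _].
    by apply/ffunP => i; rewrite ffunE tnth_mktuple.
  by apply: eq_from_tnth => i; rewrite tnth_mktuple ffunE.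
apply: eq_bigr => f _; set t := [tuple f i | i < m].
have et : size t = size Ms by rewrite size_tuple sz.
rewrite (path_weightE 0 _ et). rewrite sz.
apply: eq_bigr => i _; rewrite (nth_map i) ?size_enum_ord // nth_ord_enum.
have nth_t b (j : 'I_m) : nth b t j = f j by rewrite -tnth_nth tnth_mktuple.
rewrite nth_t; congr (M i _ _); rewrite -(nth_t (head 0 t)) /=.
(* At the last factor the path closes up: out of range, [nth] returns its default, which is the
   first entry of [t]. *)
have [->|ne_i] := eqVneq i.+1 m.
  rewrite modnn nth0 nth_default; first exact/esym/head_head.
  by rewrite size_map size_enum_ord.
by rewrite modn_small // ltn_neqAle ne_i ltn_ord.
Qed.

End TraceExpansion.

(** * The state sum over edge colourings *)

Section GaussData.

Variables (R : fieldType) (A : R) (n m : nat).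
Local Notation C := 'I_n.+2.
Variable g : C.
Local Notation wt := (cross_wt A g).
Local Notation I := ((C * C) * (C * C))%type.
Hypothesis m_gt0 : (0 < m)%N.

(** One colour for each edge replaces the four colours at each crossing: [f i] belongs to the edge
    entering position [i], [f (ordS i)] to the one leaving it. *)
Definition edge_sum (part : 'I_m -> 'I_m) (ov dr : 'I_m -> bool) : R :=
  \sum_(f : {ffun 'I_m -> C}) \prod_(i | ov i)
    wt (dr i) (f i, f (ordS i)) (f (part i), f (ordS (part i))).

Variables (P : 'I_m -> passage) (part : 'I_m -> 'I_m).
Hypothesis P_classical : forall i, ~~ is_virtual (P i).
Hypothesis partK : involutive part.
Hypothesis over_part : forall i, is_over (P (part i)) = ~~ is_over (P i).
Hypothesis label_part : forall i, label (P (part i)) = label (P i).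
Hypothesis label_inj : forall i j, label (P i) = label (P j) ->
  is_over (P i) = is_over (P j) -> i = j.

(** The trace expands over edge colourings [f]. After exchanging the sums, the colours at each
    crossing are summed independently, and the elementary matrices keep only those prescribed by
    [f]. *)
Lemma arrow_sum_edge_sum : arrow_sum A g [seq P i | i <- enum 'I_m] =
  edge_sum part (fun i => is_over (P i)) (fun i => dir (P i)).
Proof.
rewrite /arrow_sum; set w := [seq P i | i <- enum 'I_m].
pose ovs := [seq i <- enum 'I_m | is_over (P i)].
have -> : crossings w = [seq label (P i) | i <- ovs].
  by rewrite /crossings filter_map -map_comp.
have ovs_uniq : uniq [seq label (P i) | i <- ovs].
  rewrite map_inj_in_uniq => [|i j]; first exact/filter_uniq/enum_uniq.
  by rewrite !mem_filter => /andP[oi _] /andP[oj _] /label_inj; apply; rewrite oi oj.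
pose h (f : {ffun 'I_m -> C}) i (v : I) := wt (dir (P i)) v.1 v.2 *
  (pair_mx R v.1 (f i) (f (ordS i)) * pair_mx R v.2 (f (part i)) (f (ordS (part i)))).
transitivity (sumout [seq label (P i) | i <- ovs] (fun y => \sum_f \prod_(i <- ovs)
    h f i (y (label (P i)))) (fun=> ((0, 0), (0, 0)))).
  apply: eq_sumout => y; rewrite /value /word_wt /word_mx /w big_map.
  rewrite (mprodE _ (passage_mx R y)) -map_comp mxtrace_prod // big_distrr /=.
  apply: eq_bigr => f _; rewrite !big_filter !big_enum_cond /= big_split /=; congr (_ * _).
    by rewrite [RHS]big_mkcond.
  rewrite big_split /= (bigID (fun i => is_over (P i))) /=; congr (_ * _).
    by apply: eq_bigr => i; rewrite /passage_mx /is_over; case: (kind (P i)).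
  rewrite (reindex_inj (inv_inj partK)); apply: eq_big => i; first by rewrite over_part negbK.
  rewrite over_part negbK /passage_mx label_part => o.
  have := P_classical (part i); have := over_part i; rewrite o /is_over /is_virtual.
  by case: (kind _).
rewrite sumout_sum; apply: eq_bigr => f _.
rewrite (sumout_prod (h f)) //.
rewrite big_filter big_enum_cond; apply: eq_bigr => i _ /=.
rewrite (bigD1 ((f i, f (ordS i)), (f (part i), f (ordS (part i))))) //= big1.
  by rewrite addr0 /h /pair_mx !mxE !eqxx !mulr1.
case=> [[a b] [c d]] ne; rewrite /h /pair_mx /= !mxE.
case: andP => [[/eqP ea /eqP eb]|_]; last by rewrite mul0r mulr0.
case: andP => [[/eqP ec /eqP ed]|_]; last by rewrite !mulr0.
by rewrite ea eb ec ed eqxx in ne.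
Qed.

End GaussData.

(** * Counting colourings *)

(** A function constant on the fibres of [cl] factors through its image; extending it by [c0] makes
    the factorisation unique. *)
Lemma card_class_fun (T U C : finType) (cl : T -> U) (c0 : C) :
  #|[set f : {ffun T -> C} | [forall x, forall y, (cl x == cl y) ==> (f x == f y)]]| =
  (#|C| ^ #|[set cl x | x in T]|)%N.
Proof.
rewrite -(card_pffun_on c0).
have inj : {in pffun_on c0 (mem [set cl x | x in T]) (mem C) &,
    injective (fun g : {ffun U -> C} => [ffun x => g (cl x)])}.
  move=> g g' /pffun_onP[sg _] /pffun_onP[sg' _] /ffunP e; apply/ffunP => u.
  have [/imsetP[x _ ->]|nu] := boolP (u \in [set cl x | x in T]).
    by have := e x; rewrite !ffunE.
  have out (h : {ffun U -> C}) : c0.-support h \subset mem [set cl x | x in T] -> h u = c0.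
    by move/subsetP/(_ u) => s; apply/eqP; apply: contraNT nu => /s.
  by rewrite !out.
rewrite -(card_in_imset inj); apply: eq_card => f.
rewrite inE; apply/forallP/imsetP => [cf|[g _ ->] x]; last first.
  by apply/forallP => y; apply/implyP => /eqP e; rewrite !ffunE e.
exists [ffun u => if [pick x | cl x == u] is Some x then f x else c0].
  apply/pffun_onP; split=> [|c _]; last by [].
  apply/subsetP => u; rewrite inE ffunE; case: pickP => [x /eqP<- _|_]; last by rewrite eqxx.
  exact: imset_f.
apply/ffunP => x; rewrite !ffunE; case: pickP => [y e|/(_ x)]; last by rewrite eqxx.
by apply/eqP; rewrite eq_sym; have /forallP/(_ x)/implyP/(_ e) := cf y.
Qed.

Section Colourings.

Variables (T : finType) (n : nat).
Local Notation C := 'I_n.+2.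
Local Notation colouring := {ffun T -> C}.

Lemma porbit_step (s : {perm T}) x : porbit s (s x) = porbit s x.
Proof. by have := porbit_perm s 1 x; rewrite expg1. Qed.

Definition twisted (s : {perm T}) (k : T -> C) (f : colouring) : bool :=
  [forall x, f (s x) == f x + k x].

Lemma card_invariant (s : {perm T}) :
  #|[set f | twisted s (fun=> 0) f]| = (n.+2 ^ #|porbits s|)%N.
Proof.
rewrite -[n.+2 in RHS]card_ord -(card_class_fun _ ord0); apply: eq_card => f.
rewrite !inE; apply/forallP/forallP => cf x; last first.
  have /forallP/(_ x) /implyP := cf (s x); rewrite addr0; apply.
  by rewrite porbit_step.
apply/forallP => y; rewrite eq_porbit_mem; apply/implyP => /porbitP[i ->].
elim: i => [|i IH]; first by rewrite expg0 perm1.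
by rewrite expgSr permM; have := cf ((s ^+ i)%g y); rewrite addr0 => /eqP->.
Qed.

(** A twist that is the coboundary of some [h] is removed by subtracting [h]. *)
Lemma twisted_shift (s : {perm T}) (h k : T -> C) : (forall x, h (s x) = h x + k x) ->
  #|[set f | twisted s k f]| = #|[set f | twisted s (fun=> 0) f]|.
Proof.
move=> hk; pose sh (f : colouring) : colouring := [ffun x => f x + h x].
have inj : injective sh.
  by move=> f f' /ffunP e; apply/ffunP => x; have := e x; rewrite !ffunE => /addIr.
rewrite -[RHS](card_imset _ inj); apply: eq_card => f; rewrite inE.
apply/forallP/imsetP => [tf|[f']]; last first.
  rewrite inE => /forallP cf -> x; rewrite !ffunE hk; have := cf x; rewrite addr0 => /eqP->.
  by rewrite addrA.
exists [ffun x => f x - h x]; last by apply/ffunP => x; rewrite !ffunE subrK.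
rewrite inE; apply/forallP => x; rewrite !ffunE hk addr0 (eqP (tf x)).
by apply/eqP; ring.
Qed.

Variables (x y : T) (c : C).
Hypotheses (nxy : x != y) (c_neq0 : c != 0).

(** The total twist is 0 along an orbit containing both [x] and [y], but not along one that contains
    only one of them. *)
Definition kick (z : T) : C := if z == x then - c else if z == y then c else 0.

Lemma card_kick_split (s : {perm T}) : y \notin porbit s x ->
  #|[set f | twisted s kick f]| = 0%N.
Proof.
move=> ny; apply/eqP; rewrite cards_eq0; apply/eqP/setP => f; rewrite !inE.
apply/forallP => tf; case/negP: c_neq0.
have : \sum_(z in porbit s x) f (s z) = \sum_(z in porbit s x) f z.
  rewrite [RHS](reindex_inj (@perm_inj _ s)); apply: eq_bigl => z.
  by rewrite -!eq_porbit_mem porbit_step.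
under eq_bigr do rewrite (eqP (tf _)).
rewrite big_split /= => /eqP; rewrite addrC -subr_eq0 addrK (bigD1 x) ?porbit_id //=.
rewrite big1 => [|z /andP[zx /negbTE nz]]; first by rewrite addr0 /kick eqxx oppr_eq0.
rewrite /kick nz; case: eqP => // zy.
by rewrite -zy zx in ny.
Qed.

Lemma porbits_merge (s : {perm T}) : y \notin porbit s x ->
  #|porbits s| = #|porbits (tperm x y * s)|.+1.
Proof.
rewrite porbit_sym => ny; have /= := porbits_mul_tperm s x y.
by rewrite ny nxy /=; lia.
Qed.

Lemma porbits_cut (s : {perm T}) : y \in porbit s x ->
  #|porbits (tperm x y * s)| = #|porbits s|.+1.
Proof.
rewrite porbit_sym => yx; have /= := porbits_mul_tperm s x y.
by rewrite yx nxy /=; lia.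
Qed.

(** The transposition cuts the orbit into two arcs. The function [h] that is [- c] on the arc of [y]
    and 0 elsewhere has the kick as its coboundary. *)
Lemma card_kick_join (s : {perm T}) : y \in porbit s x ->
  #|[set f | twisted s kick f]| = (n.+2 ^ #|porbits s|)%N.
Proof.
move=> yx; rewrite -card_invariant; set s0 := (tperm x y * s)%g.
have nx : x \notin porbit s0 y.
  have := porbits_mul_tperm s0 x y; rewrite /= /s0 mulgA tperm2 mul1g -/s0 nxy.
  by rewrite porbits_cut //; case: (x \in _) => //=; lia.
pose h z : C := if z \in porbit s0 y then - c else 0.
apply: (twisted_shift (h := h)) => z.
have s0E u : h (s0 u) = h u by rewrite /h -!eq_porbit_mem porbit_step.
have s0x : s0 x = s y by rewrite /s0 permM tpermL.
have s0y : s0 y = s x by rewrite /s0 permM tpermR.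
have hx : h x = 0 by rewrite /h (negbTE nx).
have hy : h y = - c by rewrite /h porbit_id.
rewrite /kick; case: eqVneq => [->|zx]; first by rewrite -s0y s0E hx hy add0r.
case: eqVneq => [->|zy]; first by rewrite -s0x s0E hx hy addNr.
by rewrite addr0 -[RHS]s0E /s0 permM tpermD // eq_sym.
Qed.

(* The number of orbits changes by one under multiplication by a transposition, and a kick is
   consistent only along a single orbit. *)
Lemma card_kick (R : comPzRingType) (s : {perm T}) :
  n.+2%:R * #|[set f | twisted (tperm x y * s) (fun=> 0) f]|%:R =
  #|[set f | twisted s (fun=> 0) f]|%:R +
  (n.+2%:R ^+ 2 - 1) * #|[set f | twisted s kick f]|%:R :> R.
Proof.
rewrite !card_invariant; have [yx|ny] := boolP (y \in porbit s x).
  rewrite (card_kick_join yx) (porbits_cut yx) !natrX exprS.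
  by move: (n.+2%:R : R) (_ ^+ _) => N M; ring.
rewrite (card_kick_split ny) (porbits_merge ny) !natrX exprS.
by move: (n.+2%:R : R) (_ ^+ _) => N M; ring.
Qed.

End Colourings.

(** Both predicates select one of the two positions of each crossing, and [F] depends only on the
    crossing. *)
Lemma prod_transversal (R : comPzSemiRingType) (T : finType) (part : T -> T)
    (p q : pred T) (F : T -> R) :
  involutive part -> (forall i, p (part i) = ~~ p i) ->
  (forall i, q (part i) = ~~ q i) -> (forall i, F (part i) = F i) ->
  \prod_(i | p i) F i = \prod_(i | q i) F i.
Proof.
move=> partK pp qp Fp; rewrite (bigID q) [RHS](bigID p) /=; congr (_ * _).
  by apply: eq_bigl => i; rewrite andbC.
rewrite (reindex_inj (inv_inj partK)); apply: eq_big => i; last by rewrite Fp.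
by rewrite pp qp negbK andbC.
Qed.

(** * States as permutations of the edges *)

Section States.

Variables (R : fieldType) (n m : nat).
Local Notation C := 'I_n.+2.
Local Notation colouring := {ffun 'I_m -> C}.
Variables (part : 'I_m -> 'I_m) (mu : 'I_m -> bool).
Hypothesis partK : involutive part.
Hypothesis mu_part : forall i, mu (part i) = ~~ mu i.
Hypothesis mu_next : forall i, mu (ordS i) = ~~ mu i.

(* Edge [i] enters the crossing at position [i].  Travelling along the edges with [mu] in the
   direction of the knot and along the other ones backwards, both smoothings are coherent: at the
   crossing of a position [i] with [mu i], the edges [i] and [ordS i] arrive. *)
Definition follow (o : 'I_m -> bool) (e : 'I_m) : 'I_m :=
  if mu e then if o e then ordS (part e) else part e
  else let t := ord_pred e in if o t then part t else ordS (part t).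

Definition precede (o : 'I_m -> bool) (e : 'I_m) : 'I_m :=
  if mu e then let t := ord_pred e in if o t then part t else ordS (part t)
  else if o e then ordS (part e) else part e.

Lemma mu_pred i : mu (ord_pred i) = ~~ mu i.
Proof. by rewrite -[in RHS](ord_predK i) mu_next negbK. Qed.

Lemma follow_inj o : (forall i, o (part i) = o i) -> injective (follow o).
Proof.
move=> o_part; suff : cancel (precede o) (follow o) by move/canF_sym/can_inj.
move=> e; rewrite /precede; case mu_e: (mu e).
  case o_t: (o (ord_pred e)); rewrite /follow.
    by rewrite mu_part mu_pred mu_e /= o_part o_t partK ord_predK.
  by rewrite mu_next mu_part mu_pred mu_e /= ordSK o_part o_t partK ord_predK.
case o_e: (o e); rewrite /follow.
  by rewrite mu_next mu_part mu_e /= ordSK o_part o_e partK.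
by rewrite mu_part mu_e /= o_part o_e partK.
Qed.

(** Each edge arrives at one crossing, so the conditions can be grouped by crossings, each
    represented by its position in [mu]. *)
Lemma twisted_follow (s : {perm 'I_m}) o (k : 'I_m -> C) (f : colouring) :
  s =1 follow o ->
  twisted s k f = [forall (i | mu i), if o i
    then (f (ordS (part i)) == f i + k i) && (f (part i) == f (ordS i) + k (ordS i))
    else (f (part i) == f i + k i) && (f (ordS (part i)) == f (ordS i) + k (ordS i))].
Proof.
move=> sE; apply/forallP/forall_inP => [tf i mi|cf e].
  have := tf i; have := tf (ordS i); rewrite !sE /follow mu_next mi /= ordSK.
  by case: ifP => _ -> ->.
rewrite sE /follow; case: ifP => me.
  by have := cf e me; case: ifP => _ /andP[].
have := cf (ord_pred e); rewrite mu_pred me ord_predK => /(_ isT).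
by case: ifP => _ /andP[].
Qed.

Definition oriented_wt (f : colouring) i : R :=
  kron R (f i) (f (ordS (part i))) * kron R (f (part i)) (f (ordS i)).

Definition disoriented_wt (f : colouring) i : R :=
  kron R (f i) (f (part i)) * kron R (f (ordS i)) (f (ordS (part i))).

Variables (a b : 'I_m -> R) (i0 : 'I_m) (c : C).
Hypotheses (mu_i0 : mu i0) (c_neq0 : c != 0).

(** The disoriented smoothing at [i0] with the twist [kick i0 (ordS i0) c] on the two edges arriving
    there. *)
Definition kick_wt (f : colouring) : R :=
  kron R (f (part i0)) (f i0 - c) * kron R (f (ordS (part i0))) (f (ordS i0) + c).

Definition rest_wt (f : colouring) : R :=
  \prod_(i | mu i && (i != i0)) (a i * oriented_wt f i + b i * disoriented_wt f i).

Definition rest_state (S : {set 'I_m}) (f : colouring) : R :=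
  \prod_(i | mu i && (i != i0)) (if i \in S then oriented_wt f i else disoriented_wt f i).

Lemma sum_rest_wt : exists w : {set 'I_m} -> R,
  forall Z : colouring -> R,
  \sum_f rest_wt f * Z f = \sum_S w S * \sum_f rest_state S f * Z f.
Proof.
pose P i := mu i && (i != i0).
(* The weight 0 forces all positions outside [P] into [S], so that each state is counted once. *)
exists (fun S : {set 'I_m} =>
  \prod_i (if i \in S then if P i then a i else 1 else if P i then b i else 0)).
move=> Z; under [RHS]eq_bigr do rewrite big_distrr /=.
rewrite exchange_big; apply: eq_bigr => f _ /=.
under [RHS]eq_bigr do rewrite mulrA.
rewrite -big_distrl /=; congr (_ * _); rewrite /rest_wt big_mkcond.
transitivity (\prod_i ((if P i then a i * oriented_wt f i else 1) +
    (if P i then b i * disoriented_wt f i else 0))).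
  by apply: eq_bigr => i _; rewrite -/(P i); case: (P i); rewrite ?addr0.
rewrite bigA_distr; apply: eq_bigr => S _.
rewrite /rest_state [X in _ = _ * X]big_mkcond -big_split.
by apply: eq_bigr => i _ /=; rewrite -/(P i); case: (P i); case: ifP; rewrite ?mulr1.
Qed.

Lemma prod_bool (T : finType) (P B : pred T) :
  \prod_(i | P i) (B i)%:R = [forall (i | P i), B i]%:R :> R.
Proof.
case: forall_inP => [h|/forall_inP]; first by rewrite big1 // => i /h ->.
by rewrite negb_forall_in => /exists_inP[i Pi /negbTE nB]; rewrite (bigD1 i) //= nB mul0r.
Qed.

Lemma sum_bool (T : finType) (B : pred T) : \sum_x (B x)%:R = #|[set x | B x]|%:R :> R.
Proof. by rewrite -sum1dep_card natr_sum [RHS]big_mkcond; apply: eq_bigr => x _; case: (B x). Qed.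

Definition state_wt (o : 'I_m -> bool) (k : 'I_m -> C) (f : colouring) i : R :=
  if o i
  then kron R (f (ordS (part i))) (f i + k i) * kron R (f (part i)) (f (ordS i) + k (ordS i))
  else kron R (f (part i)) (f i + k i) * kron R (f (ordS (part i))) (f (ordS i) + k (ordS i)).

Lemma sum_state_wt (s : {perm 'I_m}) o k : s =1 follow o ->
  \sum_f \prod_(i | mu i) state_wt o k f i = #|[set f | twisted s k f]|%:R.
Proof.
move=> sE; rewrite -sum_bool; apply: eq_bigr => f _.
rewrite (twisted_follow k f sE) -prod_bool; apply: eq_bigr => i _.
by rewrite /state_wt /kron -!natrM !mulnb; case: (o i).
Qed.

(** [S] is read only at positions in [mu], which gives both passages of a crossing the same
    smoothing; [x] decides at [i0]. *)
Definition pick_state (S : {set 'I_m}) (x : bool) (i : 'I_m) : bool :=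
  let j := if mu i then i else part i in if j == i0 then x else j \in S.

Lemma pick_state_part S x i : pick_state S x (part i) = pick_state S x i.
Proof. by rewrite /pick_state mu_part if_neg partK; case: (mu i). Qed.

Definition state_perm S x : {perm 'I_m} := perm (follow_inj (pick_state_part S x)).

Lemma state_permE S x : state_perm S x =1 follow (pick_state S x).
Proof. by move=> e; rewrite permE. Qed.

Lemma state_wt0 o f i :
  state_wt o (fun=> 0) f i = if o i then oriented_wt f i else disoriented_wt f i.
Proof.
rewrite /state_wt /oriented_wt /disoriented_wt !addr0.
by case: (o i); congr (_ * _); exact: kronC.
Qed.

Lemma pick_state_i0 S x : pick_state S x i0 = x.
Proof. by rewrite /pick_state mu_i0 eqxx. Qed.

Lemma pick_state_rest S x i : mu i -> i != i0 -> pick_state S x i = (i \in S).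
Proof. by rewrite /pick_state => -> /negbTE->. Qed.

Lemma prod_state (S : {set 'I_m}) x (k : 'I_m -> C) f :
  (forall i, mu i -> i != i0 -> k i = 0 /\ k (ordS i) = 0) ->
  \prod_(i | mu i) state_wt (pick_state S x) k f i =
  rest_state S f * state_wt (fun=> x) k f i0.
Proof.
move=> k0; rewrite (bigD1 i0) //= mulrC; congr (_ * _).
  apply: eq_bigr => i /andP[mi ni]; rewrite -(pick_state_rest S x mi ni) -state_wt0.
  by have [k1 k2] := k0 i mi ni; rewrite /state_wt k1 k2.
by rewrite /state_wt pick_state_i0.
Qed.

Lemma neq_next : i0 != ordS i0.
Proof. by apply/eqP => e; have := mu_next i0; rewrite -e mu_i0. Qed.

(** The two smoothings at [i0] exchange the targets of the arriving edges [i0] and [ordS i0] and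
    agree elsewhere. *)
Lemma state_perm_switch S :
  state_perm S true = (tperm i0 (ordS i0) * state_perm S false)%g.
Proof.
apply/permP => e; rewrite permM !state_permE.
have f1 x : follow (pick_state S x) i0 = if x then ordS (part i0) else part i0.
  by rewrite /follow mu_i0 pick_state_i0.
have f2 x : follow (pick_state S x) (ordS i0) = if x then part i0 else ordS (part i0).
  by rewrite /follow mu_next mu_i0 /= ordSK pick_state_i0.
case: tpermP => [->|->|/eqP n1 /eqP n2]; rewrite ?f1 ?f2 //.
have E i : i != i0 -> i != part i0 -> pick_state S true i = pick_state S false i.
  move=> ni np; rewrite /pick_state /=; case: (mu i); first by rewrite (negbTE ni).
  by case: (eqVneq (part i) i0) => // e0; rewrite -e0 partK eqxx in np.
rewrite /follow; case: ifP => me.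
  by rewrite E //; apply: contraTneq me => ->; rewrite mu_part mu_i0.
rewrite E //; apply: contraFneq me => e0.
  by rewrite -(ord_predK e) e0 eqxx in n2.
by rewrite -(ord_predK e) e0 mu_next mu_part mu_i0.
Qed.

(** For each choice of smoothings at the other crossings, the three sums count colourings for two
    permutations that differ by a transposition, and [card_kick] relates them. *)
Lemma state_relation :
  n.+2%:R * \sum_f rest_wt f * oriented_wt f i0 =
  \sum_f rest_wt f * disoriented_wt f i0 +
  (n.+2%:R ^+ 2 - 1) * \sum_f rest_wt f * kick_wt f.
Proof.
have [w wE] := sum_rest_wt.
rewrite !wE !mulr_sumr -big_split; apply: eq_bigr => S _ /=.
pose k := kick i0 (ordS i0) c.
have k0 i : mu i -> i != i0 -> k i = 0 /\ k (ordS i) = 0.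
  move=> mi ni; rewrite /k /kick (negbTE ni) (inj_eq (can_inj (@ordSK _))) (negbTE ni).
  have -> : (ordS i == i0) = false by apply: contraTF mu_i0 => /eqP<-; rewrite mu_next mi.
  by have -> : (i == ordS i0) = false by apply: contraTF mi => /eqP->; rewrite mu_next mu_i0.
have z0 i : mu i -> i != i0 -> (0 : C) = 0 /\ (0 : C) = 0 by [].
have e1 : \sum_f rest_state S f * oriented_wt f i0 =
    #|[set f : colouring | twisted (state_perm S true) (fun=> 0) f]|%:R.
  rewrite -(sum_state_wt _ (state_permE S true)); apply: eq_bigr => f _.
  by rewrite (@prod_state S true (fun=> 0)) // state_wt0.
have e2 : \sum_f rest_state S f * disoriented_wt f i0 =
    #|[set f : colouring | twisted (state_perm S false) (fun=> 0) f]|%:R.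
  rewrite -(sum_state_wt _ (state_permE S false)); apply: eq_bigr => f _.
  by rewrite (@prod_state S false (fun=> 0)) // state_wt0.
have e3 : \sum_f rest_state S f * kick_wt f =
    #|[set f : colouring | twisted (state_perm S false) k f]|%:R.
  rewrite -(sum_state_wt _ (state_permE S false)); apply: eq_bigr => f _.
  rewrite (prod_state S false f k0) /state_wt /k /kick eqxx.
  by rewrite eq_sym (negbTE neq_next) eqxx.
rewrite e1 e2 e3 state_perm_switch.
have := card_kick neq_next c_neq0 R (state_perm S false); rewrite -/k => e.
rewrite mulrCA e; ring.
Qed.

End States.

(** * Crossing changes and virtualization *)

Lemma cross0C (R : fieldType) (A : R) n s (p q : 'I_n.+2 * 'I_n.+2) :
  cross_wt A 0 s p q = cross_wt A 0 s q p.
Proof.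
by rewrite !cross0 /bracket_wt (kronC R p.1 q.1) (kronC R p.2 q.2) (mulrC (kron R p.1 q.2)).
Qed.

(** The numbering is made for the opposite sign, so that in the disoriented smoothing the shift
    doubles the twist instead of cancelling it. *)
Lemma cross_misfit (R : fieldType) (A : R) n (g : 'I_n.+2) s p q p' q' :
  fits g s p' q' ->
  cross_wt A g (~~ s) (p + p') (q + q') = (kink A (~~ s))^-1 *
    (coef A (~~ s) * (kron R p.1 q.2 * kron R q.1 p.2) + coef A s *
     (kron R q.1 (p.1 - signed g s *+ 2) * kron R p.2 (q.2 - signed g s *+ 2))).
Proof.
case: p' q' => [a b] [c d] [/= -> -> ->]; rewrite /cross_wt /= negbK signed_neg.
have shift x y t : kron R (x + (a + t)) (y + a - t) = kron R x (y - t *+ 2).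
  by rewrite -(kronD R x _ (a + t)); congr (kron _ _ _); ring.
by rewrite !kronD !shift.
Qed.

Lemma arrow_sum_map (R : fieldType) (A : R) n (g : 'I_n.+2) w
    (P : 'I_(size w) -> passage) :
  (0 < size w)%N -> classical_diagram w ->
  (forall i, label (P i) = label (at_pos i)) ->
  (forall i, ~~ is_virtual (P i)) ->
  (forall i, is_over (P (partner i)) = ~~ is_over (P i)) ->
  arrow_sum A g [seq P i | i <- enum 'I_(size w)] =
  edge_sum A g (@partner w) (fun i => is_over (P i)) (fun i => dir (P i)).
Proof.
move=> w0 d lP vP oP; have /andP[/andP[wf_w _] cl] := d.
apply: arrow_sum_edge_sum => //; first exact: partnerK.
  by move=> i; rewrite !lP; case: (partner_spec i wf_w).
move=> i j; rewrite !lP => eL eO.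
have [_ _ _ _ /(_ i eL)] := partner_spec j wf_w.
by case=> // e; move: eO; rewrite e oP; case: is_over.
Qed.

(** * Comparison of the untwisted and the twisted sum *)

Section Assembly.

Variables (R : fieldType) (A : R) (p : nat).
Hypothesis p_prime : prime p.
Hypothesis p_odd : odd p.
Local Notation n := (Zp_trunc (pdiv p)).
Local Notation C := 'I_n.+2.
Hypothesis A_neq0 : A != 0.
Hypothesis A_loop : n.+2%:R = - A ^+ 2 - A ^- 2.
Hypothesis p_neq0 : n.+2%:R != 0 :> R.

Lemma numbering_fits w (g : C) : classical_diagram w -> exists nu : 'I_(size w) -> C,
  forall i, fits g (dir (at_pos i)) (nu i, nu (ordS i))
    (nu (partner i), nu (ordS (partner i))).
Proof.
move=> d; have /andP[/andP[wf_w _] _] := d.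
have [nu nuP] := numbering 'F_p d; exists (fun i => g * nu i) => i.
case di: (dir (at_pos i)).
  by have [e1 e2 e3] := nuP i di; split; rewrite /= ?e1 ?e2 ?e3 ?mulrDr ?mulr1.
have := nuP (partner i); rewrite dir_partner // di partnerK // => /(_ isT)[e1 e2 e3].
by split; rewrite /= ?e1 ?e2 ?e3 ?mulrDr ?mulr1 ?addrK.
Qed.

(** Modulo 2, the Alexander numbering changes by 1 along the knot at each passage and between the
    two strands entering a crossing. *)
Lemma checkerboard w : classical_diagram w -> exists mu : 'I_(size w) -> bool,
  (forall i, mu (partner i) = ~~ mu i) /\ (forall i, mu (ordS i) = ~~ mu i).
Proof.
move=> d; have /andP[/andP[wf_w _] _] := d.
have [nu nuP] := numbering 'F_2 d; exists (fun i => nu i == 0).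
have F2 (x : 'F_2) : (x + 1 == 0) = (x != 0) by case: x => [[|[|]]].
suff H i : (nu (partner i) == 0) = (nu i != 0) /\ (nu (ordS i) == 0) = (nu i != 0).
  by split=> i; have [] := H i.
case di: (dir (at_pos i)); first by have [-> -> _] := nuP i di; rewrite F2.
have := nuP (partner i); rewrite dir_partner // di partnerK // => /(_ isT)[e1 _ ->].
by rewrite e1 F2 negbK.
Qed.

Lemma edge_sum_shift m (g : C) part ov dr (nu : 'I_m -> C) :
  edge_sum A g part ov dr = \sum_(f : {ffun 'I_m -> C}) \prod_(i | ov i)
    cross_wt A g (dr i) ((f i, f (ordS i)) + (nu i, nu (ordS i)))
      ((f (part i), f (ordS (part i))) + (nu (part i), nu (ordS (part i)))).
Proof.
rewrite /edge_sum (reindex (fun f : {ffun 'I_m -> C} => [ffun i => f i + nu i])) /=.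
  by apply: eq_bigr => f _; apply: eq_bigr => i _; rewrite !ffunE.
exists (fun f => [ffun i => f i - nu i]) => f _; apply/ffunP => i; rewrite !ffunE.
  exact: addrK.
exact: subrK.
Qed.

(** The Alexander numbering scaled by [g] fits at all crossings at once, so shifting by it removes
    every twist. *)
Lemma classical_arrow_sum (g : C) w :
  classical_diagram w -> arrow_sum A g w = arrow_sum A (0 : C) w.
Proof.
move=> d; have [w0|w0] := posnP (size w).
  by rewrite (size0nil w0) !arrow_sum_nil.
have /andP[/andP[wf_w _] cl] := d.
rewrite -[w]map_at_pos !(@arrow_sum_map _ _ _ _ _ (@at_pos w)) // => *;
  rewrite ?classical_at ?over_partner //.
have [nu nuP] := numbering_fits g d; rewrite (edge_sum_shift _ _ _ _ nu).
by apply: eq_bigr => f _; apply: eq_bigr => i _; rewrite cross_fits.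
Qed.

Section CrossingChange.

Variables (K : seq passage) (v : nat).
Hypothesis K_classical : classical_diagram K.
Hypothesis v_crossing : v \in labels K.
Local Notation pos := 'I_(size K).
Local Notation part := (@partner K).
Local Notation next := (@ordS (size K)).

Let wf_K : wf K. Proof. by case/andP: K_classical => /andP[]. Qed.
Let cl_K : ~~ has is_virtual K. Proof. by case/andP: K_classical. Qed.
Let K_gt0 : (0 < size K)%N. Proof. by move: v_crossing; case: (K). Qed.
Let partK : involutive part. Proof. exact: partnerK. Qed.

(** The effect of virtualization on classical passages: at [v] the levels stay and the directions
    are reversed, which reverses the sign. *)
Definition twist (q : passage) : passage :=
  if label q == v then Passage (label q) (kind q) (~~ dir q) else q.

Lemma switch_map : switch [:: v] K = [seq (if label (at_pos i) == v
  then Passage (label (at_pos i)) (flip (kind (at_pos i))) (dir (at_pos i))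
  else at_pos i) | i <- enum pos].
Proof.
rewrite -[in LHS](map_at_pos K) /switch -map_comp; apply: eq_map => i /=.
by rewrite inE.
Qed.

Lemma real_virtualization Kv : virtualization v K Kv ->
  [seq q <- Kv | ~~ is_virtual q] = [seq twist (at_pos i) | i <- enum pos].
Proof.
case=> [x [y [anti [_ _ _ ->]]]].
rewrite (map_comp twist) map_at_pos.
elim: K cl_K => //= q w IH; rewrite negb_or => /andP[nq /IH e].
rewrite filter_cat {}e /twist; case: ifP => _; last by rewrite /= nq.
rewrite /flank; case: ifP => _; rewrite /= /is_virtual /=;
  by move: nq; rewrite /is_virtual; case: (kind q).
Qed.

Variable mu : pos -> bool.
Hypothesis mu_part : forall i, mu (part i) = ~~ mu i.
Hypothesis mu_next : forall i, mu (next i) = ~~ mu i.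
Variable i0 : pos.
Hypothesis mu_i0 : mu i0.
Hypothesis label_i0 : label (at_pos i0) = v.

(** The sign of the crossing; both of its passages give the same value, as they differ in level and
    in direction. *)
Definition positive (i : pos) : bool := is_over (at_pos i) == dir (at_pos i).

Definition strands (f : {ffun pos -> C}) i : C * C := (f i, f (next i)).

Definition others (f : {ffun pos -> C}) : R :=
  \prod_(i | mu i && (i != i0))
    cross_wt A 0 (positive i) (strands f i) (strands f (part i)).

Lemma label_v i : (label (at_pos i) == v) = (i == i0) || (i == part i0).
Proof.
have [_ l1 _ _ l2] := partner_spec i0 wf_K.
rewrite -label_i0; apply/eqP/orP => [/l2[] ->|[] /eqP-> //].
  by left.
by right.
Qed.

(** Without twist the weight is symmetric in the two strands, so a crossing may be represented by
    its position in [mu] instead of its over-passage. *)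
Lemma edge_sum0 (ov dr : pos -> bool) :
  (forall i, ov (part i) = ~~ ov i) -> (forall i, dr (part i) = ~~ dr i) ->
  (forall i, mu i -> i != i0 -> (ov i == dr i) = positive i) ->
  edge_sum A (0 : C) part ov dr = \sum_f others f *
    cross_wt A 0 (ov i0 == dr i0) (strands f i0) (strands f (part i0)).
Proof.
move=> ovp drp e; apply: eq_bigr => f _.
pose F i := cross_wt A 0 (ov i == dr i) (strands f i) (strands f (part i)).
transitivity (\prod_(i | ov i) F i).
  by apply: eq_bigr => i o; rewrite /F o; case: (dr i).
rewrite (@prod_transversal _ _ part _ mu) // => [|i]; last first.
  rewrite /F ovp drp partK cross0C; congr (cross_wt _ _ _ _ _).
  by case: (ov i) (dr i) => [] [].
rewrite (bigD1 i0) //= mulrC; congr (_ * _).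
by apply: eq_bigr => i /andP[mi ni]; rewrite /F e.
Qed.

Lemma eqb_negl b1 b2 : (~~ b1 == b2) = ~~ (b1 == b2).
Proof. by case: b1 b2 => [] []. Qed.

Let sg := positive i0.
Let X := \sum_f others f * oriented_wt R part f i0.
Let Y := \sum_f others f * disoriented_wt R part f i0.

Lemma label_other i : mu i -> i != i0 -> (label (at_pos i) == v) = false.
Proof.
move=> mi ni; rewrite label_v (negbTE ni) /=; apply: contraTF mi => /eqP->.
by rewrite mu_part mu_i0.
Qed.

Lemma sum_cross0 s : \sum_f others f * cross_wt A 0 s (strands f i0) (strands f (part i0)) =
  (kink A s)^-1 * (coef A s * X + coef A (~~ s) * Y).
Proof.
rewrite !mulr_sumr -big_split mulr_sumr /=; apply: eq_bigr => f _.
by rewrite cross0 /bracket_wt /oriented_wt /disoriented_wt /=; ring.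
Qed.

Lemma arrow_sum_K :
  arrow_sum A (0 : C) K = (kink A sg)^-1 * (coef A sg * X + coef A (~~ sg) * Y).
Proof.
rewrite -[K in LHS]map_at_pos (@arrow_sum_map _ _ _ _ _ (@at_pos K)) // => [|i|i]; last 2 first.
- exact: classical_at.
- exact: over_partner.
rewrite edge_sum0 //= => [|i|i]; rewrite ?sum_cross0 //.
  exact: over_partner.
exact: dir_partner.
Qed.

Lemma arrow_sum_switch : arrow_sum A (0 : C) (switch [:: v] K) =
  (kink A (~~ sg))^-1 * (coef A (~~ sg) * X + coef A sg * Y).
Proof.
rewrite switch_map; set P := fun i : pos => if _ then _ else _.
have oP i : is_over (P i) = if label (at_pos i) == v then ~~ is_over (at_pos i)
    else is_over (at_pos i).
  have := classical_at i cl_K; rewrite /P /is_over /is_virtual.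
  by case: ifP => //= _; case: (kind _).
have lP i : label (at_pos (part i)) = label (at_pos i).
  by case: (partner_spec i wf_K).
have dP i : dir (P i) = dir (at_pos i) by rewrite /P; case: ifP.
have oP' i : is_over (P (part i)) = ~~ is_over (P i).
  by rewrite !oP lP over_partner // -fun_if.
rewrite (@arrow_sum_map _ _ _ _ _ P) // => [|i|i].
- rewrite edge_sum0 // => [|i|i mi ni].
  + rewrite oP dP label_i0 eqxx eqb_negl sum_cross0 negbK //.
  + by rewrite !dP dir_partner.
  + by rewrite oP dP label_other.
- by rewrite /P; case: ifP.
have := classical_at i cl_K; rewrite /P /is_virtual.
by case: ifP => //= _; case: (kind _).
Qed.

Lemma twist_kind (i : pos) : kind (twist (at_pos i)) = kind (at_pos i).
Proof. by rewrite /twist; case: ifP. Qed.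

Lemma dir_twist (i : pos) : dir (twist (at_pos i)) =
  if label (at_pos i) == v then ~~ dir (at_pos i) else dir (at_pos i).
Proof. by rewrite /twist; case: ifP. Qed.

Lemma label_part (i : pos) : label (at_pos (part i)) = label (at_pos i).
Proof. by case: (partner_spec i wf_K). Qed.

Lemma arrow_sum_twist (g : C) :
  arrow_sum A g [seq twist (at_pos i) | i <- enum pos] =
  edge_sum A g part (fun i => is_over (at_pos i)) (fun i => dir (twist (at_pos i))).
Proof.
have oP (i : pos) : is_over (twist (at_pos i)) = is_over (at_pos i).
  by rewrite /is_over twist_kind.
have vP (i : pos) : ~~ is_virtual (twist (at_pos i)).
  by rewrite /is_virtual twist_kind; exact: classical_at.
have lP (i : pos) : label (twist (at_pos i)) = label (at_pos i) by rewrite /twist; case: ifP.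
have oP' i : is_over (twist (at_pos (part i))) = ~~ is_over (twist (at_pos i)).
  by rewrite !oP over_partner.
rewrite (@arrow_sum_map _ _ _ _ _ (fun i => twist (at_pos i))) //.
by apply: eq_bigr => f _; apply: eq_bigl => i; rewrite oP.
Qed.

(** The untwisted weight sees only the sign of [v], which virtualization reverses just as a crossing
    change does. *)
Lemma arrow_sum_twist0 : arrow_sum A (0 : C) [seq twist (at_pos i) | i <- enum pos] =
  (kink A (~~ sg))^-1 * (coef A (~~ sg) * X + coef A sg * Y).
Proof.
rewrite arrow_sum_twist edge_sum0 => [|i|i|i mi ni].
- rewrite dir_twist label_i0 eqxx eq_sym eqb_negl eq_sym sum_cross0 negbK //.
- exact: over_partner.
- by rewrite !dir_twist label_part dir_partner // -fun_if.
- by rewrite dir_twist label_other.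
Qed.

Lemma arrow_sum_twist1 : exists2 c : C, c != 0 &
  arrow_sum A (1 : C) [seq twist (at_pos i) | i <- enum pos] =
  (kink A (~~ sg))^-1 * (coef A (~~ sg) * X +
    coef A sg * \sum_f others f * kick_wt R part i0 c f).
Proof.
have [nu nuP] := numbering_fits (1 : C) K_classical.
(* The over-passage of the crossing: the twisted weight is not symmetric in its strands. *)
pose h i := if is_over (at_pos i) then i else part i.
pose t := signed (1 : C) sg *+ 2.
have t_neq0 : t != 0.
  have two : (2%:R : C) != 0.
    rewrite -(dvdn_pcharf (pchar_Fp p_prime)).
    by apply: contraTN p_odd => /dvdn_leq -/(_ isT); case: (p) p_prime => [|[|[]]].
  by rewrite /t; case: sg; rewrite //= mulNrn oppr_eq0.
(* The sign of the remaining twist depends on whether the passage [i0] through [v] is the upper or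
   the lower one. *)
exists (if is_over (at_pos i0) then t else - t).
  by case: ifP; rewrite ?oppr_eq0.
rewrite arrow_sum_twist (edge_sum_shift _ _ _ _ nu) !mulr_sumr -big_split mulr_sumr.
apply: eq_bigr => f _ /=.
pose N i : C * C := (nu i, nu (next i)).
pose H i := cross_wt A (1 : C) (dir (twist (at_pos (h i)))) (strands f (h i) + N (h i))
  (strands f (part (h i)) + N (part (h i))).
transitivity (\prod_(i | is_over (at_pos i)) H i).
  by apply: eq_bigr => i o; rewrite /H /h o.
have h_part i : h (part i) = h i.
  by rewrite /h over_partner // partK; case: is_over.
rewrite (@prod_transversal _ _ part _ mu) // => [|i|i]; last 2 first.
- exact: over_partner.
- by rewrite /H h_part.
have dir_h i : dir (at_pos (h i)) = positive i.
  rewrite /h /positive; case: (is_over _); first by case: (dir _).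
  by rewrite dir_partner //; case: (dir _).
have lab_h i : label (at_pos (h i)) = label (at_pos i).
  by rewrite /h; case: ifP; rewrite ?label_part.
rewrite (bigD1 i0) //= [RHS](_ : _ = ((kink A (~~ sg))^-1 *
  (coef A (~~ sg) * oriented_wt R part f i0 +
  coef A sg * kick_wt R part i0 (if is_over (at_pos i0) then t else - t) f)) * others f); last ring.
congr (_ * _).
  rewrite /H dir_twist lab_h label_i0 eqxx dir_h.
  rewrite cross_misfit; last by rewrite -dir_h; exact: nuP.
  congr (_ * (_ * _ + _ * _)); rewrite /h /oriented_wt /kick_wt; case: (is_over _) => //=.
  - by rewrite partK mulrC.
  - by congr (_ * _); rewrite -(kronD R _ _ t) subrK kronC.
  - by rewrite partK; congr (_ * _); rewrite opprK -(kronD R _ _ t) subrK kronC.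
apply: eq_bigr => i /andP[mi ni].
rewrite /H dir_twist lab_h label_other // cross_fits; last exact: nuP.
by rewrite dir_h /h; case: (is_over _); rewrite // partK cross0C.
Qed.

Lemma sum_relation (c : C) : c != 0 ->
  n.+2%:R * X = Y + (n.+2%:R ^+ 2 - 1) * \sum_f others f * kick_wt R part i0 c f.
Proof.
move=> c0.
pose a i := (kink A (positive i))^-1 * coef A (positive i).
pose b i := (kink A (positive i))^-1 * coef A (~~ positive i).
have oE f : others f = rest_wt part mu a b i0 f.
  apply: eq_bigr => i _; rewrite cross0 /bracket_wt /a /b /oriented_wt /disoriented_wt /=; ring.
have := state_relation partK mu_part mu_next a b mu_i0 c0.
by congr (_ * _ = _ + _ * _); apply: eq_bigr => f _; rewrite oE.
Qed.

Lemma arrow_sum_crossing_change :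
  arrow_sum A (0 : C) (switch [:: v] K) = n.+2%:R ->
  arrow_sum A (1 : C) [seq twist (at_pos i) | i <- enum pos] =
    arrow_sum A (0 : C) [seq twist (at_pos i) | i <- enum pos] ->
  arrow_sum A (0 : C) K = n.+2%:R.
Proof.
have [c c0 ->] := arrow_sum_twist1; have := sum_relation c0.
rewrite arrow_sum_twist0 arrow_sum_K arrow_sum_switch.
set Y2 := \sum_f _ => eXY eS /(mulfI (invr_neq0 (kink_neq0 A_neq0 _))) /addrI.
move/(mulfI (coef_neq0 A_neq0 _)) => eY.
(* With [Y2 = Y] the right-hand side of the relation becomes [n.+2 ^ 2 * Y]. *)
have {eXY} eX : X = n.+2%:R * Y.
  by apply: (mulfI p_neq0); rewrite eXY eY; ring.
(* Such a crossing behaves like a curl: for either sign, its normalised value is [Y]. *)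
have kink_Y s : (kink A s)^-1 * (coef A s * X + coef A (~~ s) * Y) = Y.
  by rewrite eX -[RHS](mulKf (kink_neq0 A_neq0 s)) -(kinkE A_neq0 A_loop s); ring.
by have := kink_Y (~~ sg); rewrite negbK eS kink_Y.
Qed.

End CrossingChange.

Lemma arrow_sum_of_classical_virtualization K Kv w v :
  classical_diagram K -> v \in labels K -> unknot (switch [:: v] K) ->
  virtualization v K Kv -> classical_diagram w -> virtual_equiv Kv w ->
  arrow_sum A (0 : C) K = n.+2%:R.
Proof.
move=> dK v_in unk virt dw e.
have [mu [mu_part mu_next]] := checkerboard dK.
have /andP[/andP[wf_K _] _] := dK.
have [i0 mu_i0 label_i0] : exists2 i : 'I_(size K), mu i & label (at_pos i) = v.
  move: v_in; rewrite -[K in labels K]map_at_pos /labels -map_comp => /mapP[i _ ->].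
  case mi: (mu i); first by exists i.
  by exists (partner i); rewrite ?mu_part ?mi //; case: (partner_spec i wf_K).
have eKv (g : C) : arrow_sum A g [seq twist v (at_pos i) | i <- enum 'I_(size K)] =
    arrow_sum A g w.
  rewrite -(real_virtualization dK virt) arrow_sum_filter.
  exact: (virtual_equiv_arrow_sum A_neq0 A_loop g e).
apply: (arrow_sum_crossing_change dK v_in mu_part mu_next mu_i0 label_i0).
  rewrite (classical_equiv_arrow_sum A_neq0 A_loop _ unk).
  exact: arrow_sum_nil.
by rewrite !eKv classical_arrow_sum.
Qed.

End Assembly.

(** * The Jones polynomial *)

Lemma prodD_powerset (R : comPzRingType) (T : finType) (D : {set T}) (F G : T -> R) :
  \prod_(i in D) (F i + G i) =
  \sum_(S in powerset D) \prod_(i in D) (if i \in S then F i else G i).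
Proof.
pose F' i := if i \in D then F i else 0; pose G' i := if i \in D then G i else 1.
transitivity (\prod_i (F' i + G' i)).
  rewrite big_mkcond; apply: eq_bigr => i _; rewrite /F' /G'.
  by case: ifP; rewrite ?add0r.
rewrite bigA_distr [RHS]big_mkcond; apply: eq_bigr => S _.
rewrite inE; case: ifPn => [sub|/subsetPn[i Si nD]]; last first.
  by rewrite (bigD1 i) //= Si /F' (negbTE nD) mul0r.
rewrite [RHS]big_mkcond; apply: eq_bigr => i _; rewrite /F' /G'.
by case: (boolP (i \in D)) => // /negP nD; rewrite ifN //; apply/negP => /(subsetP sub).
Qed.

(** * The state sum as a value of the Jones polynomial *)

Section Evaluation.

Variables (R : fieldType) (A : R) (n : nat) (K : seq passage).
Local Notation C := 'I_n.+2.
Local Notation pos := 'I_(size K).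
Hypothesis A_neq0 : A != 0.
Hypothesis A_loop : n.+2%:R = - A ^+ 2 - A ^- 2.
Hypothesis K_classical : classical_diagram K.
Hypothesis K_gt0 : (0 < size K)%N.

Let wf_K : wf K. Proof. by case/andP: K_classical => /andP[]. Qed.
Let cl_K : ~~ has is_virtual K. Proof. by case/andP: K_classical. Qed.
Let partK : involutive (@partner K). Proof. exact: partnerK. Qed.

Definition oriented (S : {set pos}) (i : pos) : bool :=
  (over_pos i \in S) == dir (at_pos (over_pos i)).

Lemma over_pos_partner (i : pos) : over_pos (partner i) = over_pos i.
Proof. by rewrite /over_pos over_partner //; case: is_over; rewrite ?partK. Qed.

Lemma smoothE (S : {set pos}) (x : dart K) :
  smooth S x = (partner x.1, if oriented S x.1 then ~~ x.2 else x.2).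
Proof.
by rewrite /smooth ifN ?classical_at // /oriented; case: ifP.
Qed.

Lemma smoothK (S : {set pos}) : involutive (smooth S).
Proof.
case=> i b; rewrite !smoothE /= partK /oriented over_pos_partner.
by case: (_ == dir _); rewrite ?negbK.
Qed.

Definition join_rel (S : {set pos}) : rel (dart K) :=
  fun x y => (y == edge x) || (y == smooth S x).

Lemma join_rel_sym S : connect_sym (join_rel S).
Proof.
apply: sym_connect_sym => x y; rewrite /join_rel.
by congr (_ || _); apply/eqP/eqP => ->; rewrite ?edgeK ?smoothK.
Qed.

Lemma loopsE S : loops S = #|[set fingraph.root (join_rel S) x | x in dart K]|.
Proof.
rewrite /loops /n_comp_mem; apply: eq_card => x; rewrite !inE andbT.
apply/idP/imsetP => [/eqP e|[y _ ->]]; first by exists x.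
exact: roots_root (join_rel_sym S) y.
Qed.

Definition coherent (S : {set pos}) (f : {ffun pos -> C}) : bool :=
  [forall (i | is_over (at_pos i)), if oriented S i
   then (f i == f (ordS (partner i))) && (f (partner i) == f (ordS i))
   else (f i == f (partner i)) && (f (ordS i) == f (ordS (partner i)))].

Definition dart_colour (f : {ffun pos -> C}) : {ffun dart K -> C} :=
  [ffun x : dart K => if x.2 then f (ordS x.1) else f x.1].

(** Darts joined by an edge or by a smoothing carry the same colour, so a coherent colouring chooses
    one colour for each loop. *)
Lemma card_coherent S : #|[set f | coherent S f]| = (n.+2 ^ loops S)%N.
Proof.
rewrite loopsE -[n.+2 in RHS]card_ord.
rewrite -(card_class_fun (fingraph.root (join_rel S)) (ord0 : 'I_n.+2)).
have inj : injective dart_colour.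
  move=> f f' /ffunP e; apply/ffunP => i.
  by have := e (i, false); rewrite !ffunE.
rewrite -(card_imset _ inj); apply: eq_card => F; rewrite [in RHS]inE.
apply/imsetP/forallP => [[f]|cF].
  rewrite inE => /forall_inP cf -> x; apply/forallP => y; apply/implyP.
  move/eqP/(fingraph.rootP (join_rel_sym S))/connectP=> [s].
  elim: s x => [|z s IH] x /=; first by move=> _ ->.
  case/andP=> xz zs ly; rewrite -(eqP (IH z zs ly)) {IH zs ly y s}.
  case/orP: xz => /eqP->; first by rewrite !ffunE; case: x => i [] /=; rewrite ?ord_predK.
  rewrite smoothE !ffunE; case: x => i b /=.
  have [o|o] := boolP (is_over (at_pos i)).
    by have := cf i o; case: ifP => _ /andP[/eqP e1 /eqP e2]; case: b; rewrite /= ?e1 ?e2.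
  have := cf (partner i); rewrite over_partner // o partK /oriented over_pos_partner.
  move/(_ isT); rewrite -/(oriented S i).
  by case: ifP => _ /andP[/eqP e1 /eqP e2]; case: b; rewrite /= ?e1 ?e2.
have cF' x y : join_rel S x y -> F x = F y.
  move=> xy; apply/eqP; have /forallP/(_ y)/implyP := cF x; apply; apply/eqP.
  exact/(fingraph.rootP (join_rel_sym S))/connect1.
pose f : {ffun pos -> C} := [ffun i => F (i, false)].
have eF : F = dart_colour f.
  apply/ffunP => -[i []]; rewrite !ffunE //=.
  by apply: cF'; rewrite /join_rel /edge /= eqxx.
exists f => //; rewrite inE; apply/forall_inP => i _.
have sF b : F (i, b) = F (partner i, if oriented S i then ~~ b else b).
  by apply: cF'; rewrite /join_rel smoothE /= eqxx orbT.
have := sF true; have := sF false; rewrite eF !ffunE /=.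
by case: (oriented S i) => /= -> ->; rewrite !eqxx.
Qed.

(** The formula of [jones] with an arbitrary field element in place of [varA]. *)
Definition jones_at : R :=
  (- A ^+ 3) ^ (- writhe K) *
  \sum_(S in powerset (overs K))
    A ^ (#|S|%:Z - #|overs K :\: S|%:Z) * (- A ^+ 2 - A ^- 2) ^+ (loops S).-1.

Lemma loops_gt0 (S : {set pos}) : (0 < loops S)%N.
Proof.
rewrite loopsE card_gt0; apply/set0Pn.
by exists (fingraph.root (join_rel S) (Ordinal K_gt0, true)); exact: imset_f.
Qed.

(** The factor arises because colourings count every loop, while the bracket gives a single loop the
    value 1. *)
Lemma arrow_sum_jones : arrow_sum A (0 : C) K = n.+2%:R * jones_at.
Proof.
rewrite -[K in LHS]map_at_pos (@arrow_sum_map _ _ _ _ _ (@at_pos K)) // => [|i|i]; last 2 first.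
- exact: classical_at.
- exact: over_partner.
(* [al] and [be] belong to the smoothings weighted by [A] and by its inverse; the sign of the
   crossing decides which of them is oriented. *)
pose al (f : {ffun pos -> C}) i := if dir (at_pos i)
  then oriented_wt R (@partner K) f i else disoriented_wt R (@partner K) f i.
pose be (f : {ffun pos -> C}) i := if dir (at_pos i)
  then disoriented_wt R (@partner K) f i else oriented_wt R (@partner K) f i.
transitivity ((\prod_(i in overs K) (kink A (dir (at_pos i)))^-1) *
    \sum_(f : {ffun pos -> C}) \prod_(i in overs K) (A * al f i + A^-1 * be f i)).
  rewrite big_distrr; apply: eq_bigr => f _ /=; rewrite -big_split.
  apply: eq_big => [i|i _ /=]; first by rewrite inE.
  rewrite cross0 /bracket_wt /al /be /oriented_wt /disoriented_wt /=.
  by case: (dir _) => /=; ring.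
under [X in _ * X]eq_bigr do rewrite prodD_powerset.
rewrite exchange_big /= /jones_at mulrCA; congr (_ * _).
  rewrite /writhe -sumrN.
  rewrite (big_morph (fun z => (- A ^+ 3) ^ z) (id1 := 1) (op1 := *%R)) //; last first.
    by move=> a b; rewrite expfzDr // oppr_eq0 expf_neq0.
  apply: eq_bigr => i _; rewrite /kink; case: (dir _) => //=.
  by rewrite opprK exprVn -invrN invrK.
rewrite big_distrr; apply: eq_bigr => S; rewrite powersetE => sub /=.
transitivity (A ^ (#|S|%:Z - #|overs K :\: S|%:Z) *
    \sum_(f : {ffun pos -> C}) \prod_(i in overs K) (if oriented S i
      then oriented_wt R (@partner K) f i else disoriented_wt R (@partner K) f i)).
  rewrite big_distrr; apply: eq_bigr => f _ /=.
  have -> : A ^ (#|S|%:Z - #|overs K :\: S|%:Z) =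
      \prod_(i in overs K) (if i \in S then A else A^-1).
    rewrite (bigID (fun i => i \in S)) /= expfzDr //; congr (_ * _).
      rewrite (eq_bigl (fun i => i \in S)) => [|i]; last first.
        by case: (boolP (i \in S)) => [/(subsetP sub) -> //|]; rewrite andbF.
      by rewrite (eq_bigr (fun=> A)) => [|i ->] //; rewrite prodr_const.
    rewrite (eq_bigr (fun=> A^-1)) => [|i /andP[_ /negbTE->]] //.
    rewrite prodr_const -exprnN exprVn; congr ((_ ^+ _)^-1).
    by apply: eq_card => i; rewrite in_setD [RHS]unfold_in /= andbC.
  rewrite -big_split; apply: eq_bigr => i; rewrite inE => o /=.
  rewrite /oriented /over_pos o /al /be.
  by case: (i \in S) (dir _) => [] [].
rewrite mulrCA; congr (_ * _).
rewrite -A_loop -exprS prednK ?loops_gt0 // -natrX -card_coherent -sum_bool.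
apply: eq_bigr => f _; rewrite /coherent -prod_bool; apply: eq_big => [i|i _]; first by rewrite inE.
by rewrite /oriented_wt /disoriented_wt /kron -!natrM !mulnb; case: (oriented S i).
Qed.

End Evaluation.

(* A Laurent polynomial over the integers, as a function on every field at once. *)
Definition laurent (h : forall L : fieldType, L -> L) : Prop :=
  exists (M : nat) (P : {poly int}), forall (L : fieldType) (u : L), u != 0 ->
    u ^+ M * h L u = (map_poly intr P).[u].

Lemma eq_laurent h h' : (forall (L : fieldType) (u : L), u != 0 -> h L u = h' L u) ->
  laurent h -> laurent h'.
Proof. by move=> e [M [P hP]]; exists M, P => L u u0; rewrite -e // hP. Qed.

Lemma laurent_int (z : int) : laurent (fun L _ => z%:~R).
Proof.
by exists 0%N, z%:P => L u _; rewrite expr0 mul1r map_polyC hornerC.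
Qed.

Lemma laurent_id : laurent (fun L u => u).
Proof. by exists 0%N, 'X => L u _; rewrite expr0 mul1r map_polyX hornerX. Qed.

Lemma laurent_inv : laurent (fun L u => u^-1).
Proof.
by exists 1%N, 1 => L u u0; rewrite expr1 mulfV // rmorph1 hornerE.
Qed.

Lemma laurentD h h' : laurent h -> laurent h' -> laurent (fun L u => h L u + h' L u).
Proof.
move=> [M [P hP]] [N [Q hQ]]; exists (M + N)%N, ('X^N * P + 'X^M * Q) => L u u0.
rewrite rmorphD !rmorphM /= !map_polyXn !hornerE -hP // -hQ // exprD; ring.
Qed.

Lemma laurentM h h' : laurent h -> laurent h' -> laurent (fun L u => h L u * h' L u).
Proof.
move=> [M [P hP]] [N [Q hQ]]; exists (M + N)%N, (P * Q) => L u u0.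
by rewrite rmorphM hornerM -hP // -hQ // exprD mulrACA.
Qed.

Lemma laurentN h : laurent h -> laurent (fun L u => - h L u).
Proof.
by move=> [M [P hP]]; exists M, (- P) => L u u0; rewrite rmorphN hornerN -hP // mulrN.
Qed.

Lemma laurentX h k : laurent h -> laurent (fun L u => h L u ^+ k).
Proof.
move=> lh; elim: k => [|k IH].
  by apply: eq_laurent (laurent_int 1) => L u _; rewrite expr0.
by apply: eq_laurent (laurentM lh IH) => L u _; rewrite exprS.
Qed.

Lemma laurent_sum (T : finType) (D : {pred T}) (h : T -> forall L : fieldType, L -> L) :
  (forall x, laurent (h x)) -> laurent (fun L u => \sum_(x in D) h x L u).
Proof.
move=> lh; suff H s : laurent (fun L u => \sum_(x <- s | x \in D) h x L u) by exact: H.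
elim: s => [|x s IH].
  by apply: eq_laurent (laurent_int 0) => L u _; rewrite big_nil.
case: (boolP (x \in D)) => Dx.
  by apply: eq_laurent (laurentD (lh x) IH) => L u _; rewrite big_cons Dx.
by apply: eq_laurent IH => L u _; rewrite big_cons (negbTE Dx).
Qed.

(** Inverses of Laurent polynomials need not be Laurent polynomials, so [h'] supplies the inverse
    for negative exponents. *)
Lemma laurent_exprz h h' (z : int) :
  (forall (L : fieldType) (u : L), u != 0 -> (h L u)^-1 = h' L u) ->
  laurent h -> laurent h' -> laurent (fun L u => h L u ^ z).
Proof.
move=> hV lh lh'; case: z => k; first exact: laurentX.
by apply: eq_laurent (laurentX k.+1 lh') => L u u0; rewrite NegzE -exprnN -exprVn hV.
Qed.

(** The variable [u] stands for the fourth root of t, of which [varA] is the inverse. *)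
Lemma laurent_jones K : laurent (fun L u => jones_at u^-1 K).
Proof.
have lA := laurent_inv; have lu := laurent_id.
apply: laurentM.
  apply: (laurent_exprz (h' := fun L u => - u ^+ 3)).
  - by move=> L u _; rewrite invrN exprVn invrK.
  - exact/laurentN/laurentX.
  - exact/laurentN/laurentX.
apply: laurent_sum => S; apply: laurentM.
  by apply: (laurent_exprz (h' := fun L u => u)) => // L u _; rewrite invrK.
apply/laurentX/laurentD; first exact/laurentN/laurentX.
apply/laurentN; apply: eq_laurent (laurentX 2 lu) => L u _.
by rewrite exprVn invrK.
Qed.

Lemma tofrac_horner (P : {poly int}) :
  (map_poly intr P).[tofrac 'X] = tofrac P.
Proof.
rewrite horner_poly -[in RHS](coefK P) poly_def rmorph_sum.
apply: eq_bigr => i _; rewrite -mul_polyC rmorphM rmorphXn /=; congr (_ * _).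
by rewrite -[P`_i in RHS]intz -[(_%:~R)%:P]/(polyC _) rmorph_int rmorph_int.
Qed.

(** Clearing denominators leaves an integer polynomial that agrees with ['X^M] at more points than
    their difference could have roots. The resulting identity holds in every field. *)
Lemma laurent_eq1 h (good : algC -> Prop) : laurent h ->
  (forall k, exists rs, [/\ size rs = k, uniq rs & forall u, u \in rs -> good u]) ->
  (forall u, good u -> u != 0 /\ h algC u = 1) ->
  h {fraction {poly int}} (tofrac 'X) = 1.
Proof.
move=> [M [P hP]] many goodP.
have X0 : tofrac ('X : {poly int}) != 0 by rewrite tofrac_eq0 polyX_eq0.
have P_eq : P = 'X^M.
  apply/eqP; rewrite -subr_eq0; set Q := P - _.
  have Q0 : map_poly (intr : int -> algC) Q = 0.
    apply/eqP; apply: contraT => nz.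
    have [rs [sz u_rs g_rs]] := many (size (map_poly (intr : int -> algC) Q)).
    have := max_poly_roots nz _ u_rs; rewrite sz ltnn => -> //.
    apply/allP => u /g_rs/goodP[u0 hu]; apply/rootP.
    by rewrite rmorphB /= hornerD hornerN map_polyXn hornerXn -hP // hu mulr1 subrr.
  by apply/eqP/(map_inj_poly (@intr_inj algC) (rmorph0 _)); rewrite Q0 rmorph0.
have := hP _ _ X0; rewrite tofrac_horner P_eq rmorphXn => e.
by apply: (mulfI (expf_neq0 M X0)); rewrite e mulr1.
Qed.

Definition loop_value (p : nat) (u : algC) : Prop :=
  u != 0 /\ p%:R = - u ^+ 2 - u ^- 2.

Lemma loop_value_inv p u : loop_value p u -> loop_value p u^-1.
Proof.
by case=> u0 e; split; rewrite ?invr_eq0 // e !exprVn invrK addrC.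
Qed.

Lemma loop_value_exists p : exists u, loop_value p u.
Proof.
(* The equation is [u^4 = - p u^2 - 1], the loop relation multiplied by [u^2]. *)
have [//|u] := @solve_monicpoly algC 4
  (fun i => if i == 0%N then -1 else if i == 2%N then - p%:R else 0).
rewrite !big_ord_recl big_ord0 /= => e; exists u.
have u0 : u != 0.
  apply/eqP => u0; move: e; rewrite u0 !expr0n /= !mulr0 mulr1 !addr0 => /eqP.
  by rewrite eq_sym oppr_eq0 oner_eq0.
split=> //; apply: (mulIf (expf_neq0 2 u0)).
have e4 : u ^+ 4 = - 1 - p%:R * u ^+ 2 by rewrite e /bump /= expr0; ring.
by rewrite mulrBl mulVf ?expf_neq0 // mulNr -exprD e4; ring.
Qed.

(** The loop relation recovers the prime from the point, so distinct primes give distinct points. *)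
Lemma loop_value_many k : exists rs, [/\ size rs = k, uniq rs &
  forall u, u \in rs -> exists p, [/\ prime p, odd p & loop_value p u]].
Proof.
suff [B [rs [sz u_rs rsP]]] : exists B rs, [/\ size rs = k, uniq rs &
    forall u, u \in rs -> exists p, [/\ prime p, odd p, (p <= B)%N & loop_value p u]].
  by exists rs; split=> // u /rsP[p [? ? _ ?]]; exists p.
elim: k => [|k [B [rs [sz u_rs rsP]]]]; first by exists 0%N, [::].
(* Exceeding [B] makes the prime new, and exceeding 2 makes it odd. *)
have [p Bp pr_p] := prime_above (maxn B 2); rewrite gtn_max in Bp.
have [/andP[lt_B gt_2] [u up]] := (Bp, loop_value_exists p).
exists p, (u :: rs); split=> [||w]; first by rewrite /= sz.
  rewrite /= u_rs andbT; apply/negP => /rsP[q [_ _ le_q [_ eq]]].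
  case: up => _; rewrite -eq => /eqP; rewrite eqr_nat => /eqP e.
  by rewrite e ltnNge le_q in lt_B.
rewrite inE => /predU1P[->|/rsP[q [? ? le_q ?]]]; last first.
  by exists q; split=> //; exact: leq_trans le_q (ltnW lt_B).
by exists p; split=> //; case: (even_prime pr_p) => // p2; rewrite p2 in gt_2.
Qed.

Theorem corollary3p5 (K Kv : seq passage) (v : nat)
  (K_classical : classical_diagram K)
  (v_crossing : v \in labels K)
  (K_unknotting : unknotting_number K 1%N)
  (K_jones : jones K <> 1)
  (Ks_unknot : unknot (switch [:: v] K))
  (Kv_virtualization : virtualization v K Kv) :
  non_classical Kv /\ non_trivial Kv.
Proof.
have Kv_nonclassical : non_classical Kv.
  move=> w w_classical Kv_w; apply: K_jones.
  have K_gt0 : (0 < size K)%N by move: v_crossing; case: (K).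
  apply: (laurent_eq1 (laurent_jones K) loop_value_many) => u [p [pr_p odd_p up]].
  have u0 : u != 0 by case: up.
  (* The state sum is taken at the inverse of [u]; [Fp_cast] rewrites the prime as the number of
     colours. *)
  split=> //; have [Vu0] := loop_value_inv up; rewrite -{1}(Fp_cast pr_p) => eV.
  have p0 : (Zp_trunc (pdiv p)).+2%:R != 0 :> algC by rewrite pnatr_eq0.
  have := arrow_sum_of_classical_virtualization pr_p odd_p Vu0 eV p0 K_classical
    v_crossing Ks_unknot Kv_virtualization w_classical Kv_w.
  rewrite (arrow_sum_jones Vu0 eV K_classical K_gt0) -[RHS]mulr1.
  exact: mulfI.
(* The crossingless diagram is itself classical. *)
by split=> // Kv_trivial; exact: (Kv_nonclassical [::]).
Qed.
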